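(* For every $f\in F$ the set $\mu_T^{-1}(f)$ is a real codimension two compact connected smooth symplectic submanifold of $M$. For each $v\in V$, the set $M_v$ is dense in $M$, and the diffeomorphism $\psi_v:U_v\to M_v$ is maximal among all diffeomorphisms from open subsets of $\mathbb{C}^{F_v}$ onto open subsets of $M$ (that is, it has no extension to a diffeomorphism from a strictly larger open subset of $\mathbb{C}^{F_v}$ onto an open subset of $M$).
   Context: For a finite set $B$ and a set $A$, $A^B$ is the set of functions $B\to A$; for $z\in A^B$ write $z_f=z(f)$. Let $T$ be an $n$-dimensional torus (compact, connected, commutative Lie group) with Lie algebra $\mathfrak{t}$, exponential map $\exp:\mathfrak{t}\to T$, and integral lattice $\mathfrak{t}_{\mathbb{Z}}:=\ker(\exp)$; the induced isomorphism $\mathfrak{t}/\mathfrak{t}_{\mathbb{Z}}\to T$ is also denoted $\exp$. Let $\Delta\subset\mathfrak{t}^*$ be an $n$-dimensional convex polytope, $F$ the set of its codimension one faces, $V$ the set of its vertices, and $F_v=\{f\in F\mid v\in f\}$ for $v\in V$. Assume $\Delta$ is a Delzant polytope: (i) for each $f\in F$ there are $X_f\in\mathfrak{t}$, $\lambda_f\in\mathbb{R}$ such that the hyperplane containing $f$ is $\{\xi\mid\langle X_f,\xi\rangle+\lambda_f=0\}$ and $\Delta\subset\{\xi\mid\langle X_f,\xi\rangle+\lambda_f\ge 0\}$ (with $X_f$ normalized to be primitive in $\mathfrak{t}_{\mathbb{Z}}$, which makes $X_f,\lambda_f$ unique); (ii) for every $v\in V$ the $X_f$, $f\in F_v$, form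 a $\mathbb{Z}$-basis of $\mathfrak{t}_{\mathbb{Z}}$. Hence $\#F_v=n$ and $\Delta=\{\xi\in\mathfrak{t}^*\mid\langle X_f,\xi\rangle+\lambda_f\ge0\ \forall f\in F\}$. Let $\pi:\mathbb{R}^F\to\mathfrak{t}$, $\pi(t)=\sum_{f\in F}t_fX_f$, and let $\pi':\mathbb{R}^F/\mathbb{Z}^F\to\mathfrak{t}/\mathfrak{t}_{\mathbb{Z}}$ be the induced surjective homomorphism. Put $\mathfrak{n}=\ker\pi$ and $N=\ker(\exp\circ\pi')\subset\mathbb{R}^F/\mathbb{Z}^F$ (a torus with Lie algebra $\mathfrak{n}$). The torus $\mathbb{R}^F/\mathbb{Z}^F$ acts on $\mathbb{C}^F$ by $(t\cdot z)_f=e^{2\pi i t_f}z_f$. On $\mathbb{C}^F$ put the symplectic form $\sigma=\frac{1}{2\pi}\sum_{f\in F}dx_f\wedge dy_f$, $z_f=x_f+iy_f$, and let $\mu:\mathbb{C}^F\to(\mathbb{R}^F)^*\simeq\mathbb{R}^F$, $\mu(z)_f=|z_f|^2/2$, be the momentum map of the torus action. Let $\iota_{\mathfrak n}^*:(\mathbb{R}^F)^*\to\mathfrak{n}^*$ be restriction to $\mathfrak{n}$, $\lambda=(\lambda_f)_{f\in F}\in(\mathbb{R}^F)^*$, $\mu_N=\iota_{\mathfrak n}^*\circ\mu$, $\lambda_N=\iota_{\mathfrak n}^*(\lambda)$, and $Z:=\mu_N^{-1}(\{\lambda_N\})\subset\mathbb{C}^F$. Then $Z$ is a compact smooth submanifold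 on which $N$ acts freely, and $M:=Z/N$, with projection $p:Z\to M$, is a compact connected smooth $2n$-dimensional manifold (the Delzant space of $\Delta$) with the unique symplectic form $\sigma_M$ such that $p^*\sigma_M=\sigma|_Z$. The torus $T\simeq(\mathbb{R}^F/\mathbb{Z}^F)/N$ (via $\exp\circ\pi'$) acts on $M$ with momentum map $\mu_T:M\to\mathfrak{t}^*$ determined by $\pi^*\circ\mu_T\circ p=(\mu-\lambda)|_Z$, and $\mu_T(M)=\Delta$. For $v\in V$: $\rho_v:\mathbb{C}^F\to\mathbb{C}^{F_v}$ is restriction of functions to $F_v$; $U_v$ is the interior of $\rho_v(Z)$ in $\mathbb{C}^{F_v}$; $Z_v:=\rho_v^{-1}(U_v)\cap Z$; $M_v:=Z_v/N$, an open subset of $M$; $\mu_v:\mathbb{C}^{F_v}\to\mathfrak{t}^*$ is defined by $|z_f|^2/2-\lambda_f=\langle X_f,\mu_v(z)\rangle$ for all $f\in F_v$. For $f\in F$, $r_f:\Delta\to\mathbb{R}_{\ge0}$ is $r_f(\xi)=(2(\langle X_f,\xi\rangle+\lambda_f))^{1/2}$. The map $s_v:U_v\to Z_v$ is given by $s_v(z)_f=z_f$ for $f\in F_v$ and $s_v(z)_{f'}=r_{f'}(\mu_v(z))$ for $f'\in F\setminus F_v$, and $\psi_v:=p\circ s_v:U_v\to M_v$, which is a $T$-equivariant symplectomorphism onto $M_v$, where $\mathbb{C}^{F_v}$ has the symplectic form $\frac{1}{2\pi}\sum_{f\in F_v}dx_f\wedge dy_f$ and $T\simeq\mathbb{R}^{F_v}/\mathbb{Z}^{F_v}$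 (via $\sum_{f\in F_v}t_fX_f\leftrightarrow t$) acts by $(t\cdot z)_f=e^{2\pi i t_f}z_f$. *)

(* Defs.v *)
From HB Require Import structures.
From mathcomp Require Import all_boot all_order all_algebra.
From mathcomp Require Import all_classical all_reals all_analysis.
From mathcomp Require Import ring.
Set Implicit Arguments.
Unset Strict Implicit.
Unset Printing Implicit Defensive.
Import Order.TTheory GRing.Theory Num.Theory.
Import numFieldNormedType.Exports.
Local Open Scope classical_set_scope.
Local Open Scope ring_scope.
Local Open Scope quotient_scope.

(* On finite-dimensional spaces this is the usual class C^k: a map is C^(k+1)
   when it is differentiable and all its directional derivatives are C^k. *)
Fixpoint Ck {R : realType} {E E' : normedModType R} (k : nat)
    (O : set E) (f : E -> E') : Prop :=
  match k with
  | 0 => forall x, O x -> {for x, continuous f}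
  | k'.+1 => (forall x, O x -> differentiable f x) /\
             (forall v : E, Ck k' O (fun x => 'D_v f x))
  end.

(* Meant for open O. *)
Definition Cinfty {R : realType} {E E' : normedModType R}
    (O : set E) (f : E -> E') : Prop := forall k, Ck k O f.

(* Arbitrary A: local existence of smooth extensions to the ambient space. *)
Definition smooth_on {R : realType} {E E' : normedModType R}
    (A : set E) (f : E -> E') : Prop :=
  forall x, A x -> exists O : set E, exists g : E -> E',
    [/\ open O, O x, Cinfty O g & {in O `&` A, g =1 f}].

(* Smooth curves in A, defined near time 0, passing through x at time 0. *)
Definition curve_at {R : realType} {E : normedModType R}
    (A : set E) (x : E) (g : R^o -> E) : Prop :=
  exists O : set R^o, [/\ open O, O 0, Cinfty O g, g @` O `<=` A & g 0 = x].

Definition tangent {R : realType} {E : normedModType R}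
    (A : set E) (x : E) : set E :=
  [set 'D_1 g (0 : R^o) | g in curve_at A x].

(* A chart of dimension m; cmap and cinv are only relevant on cdom and on
   cimg = cmap(cdom). *)
Record chart (R : realType) (M : topologicalType) (m : nat) := Chart {
  cdom : set M;
  cmap : M -> 'rV[R]_m;
  cinv : 'rV[R]_m -> M }.

Definition cimg {R : realType} {M : topologicalType} {m : nat}
    (c : chart R M m) : set 'rV[R]_m := cmap c @` cdom c.

Definition is_chart {R : realType} {M : topologicalType} {m : nat}
    (c : chart R M m) : Prop :=
  [/\ open (cdom c), open (cimg c),
      forall x, cdom c x -> cinv c (cmap c x) = x,
      {within cdom c, continuous (cmap c)}
    & {within cimg c, continuous (cinv c)}].

Definition atlas (R : realType) (M : topologicalType) (m : nat) :=
  set (chart R M m).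

Section Manifold.
Context {R : realType} {M : topologicalType} {m : nat}.
Implicit Types (A : atlas R M m) (c : chart R M m).

(* In the following definitions A is meant to be a maximal atlas. *)

Definition smooth_to A {E : normedModType R} (U : set E) (g : E -> M) : Prop :=
  forall x, U x -> exists c, exists O : set E,
    [/\ A c, open O, O x /\ O `<=` U, g @` O `<=` cdom c
      & Cinfty O (cmap c \o g)].

Definition smooth_from A {E : normedModType R} (W : set M) (h : M -> E) : Prop :=
  forall x, W x -> exists c,
    [/\ A c, cdom c x, cdom c `<=` W & Cinfty (cimg c) (h \o cinv c)].

(* g restricts to a diffeomorphism from the open set U of E onto an open subset
   of M. *)
Definition diffeo_onto_open A {E : normedModType R} (U : set E) (g : E -> M)
    : Prop :=
  [/\ open U, open (g @` U), smooth_to A U g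
    & exists h : M -> E,
        (forall u, U u -> h (g u) = u) /\ smooth_from A (g @` U) h].

Definition maximal_diffeo A {E : normedModType R} (U : set E) (g : E -> M)
    : Prop :=
  diffeo_onto_open A U g /\
  forall (U' : set E) (g' : E -> M),
    diffeo_onto_open A U' g' -> U `<=` U' -> {in U, g' =1 g} -> U' = U.

(* S is an embedded submanifold of codimension k: near each of its points there
   is a slice chart. *)
Definition submanifold A (k : nat) (S : set M) : Prop :=
  (k <= m)%N /\
  forall x, S x -> exists c, [/\ A c, cdom c x &
    cmap c @` (cdom c `&` S) =
    cimg c `&` [set y | forall i : 'I_m, (m - k <= i)%N -> y ord0 i = 0]].

(* A 2-form is given by its expressions in charts: w c y u v is the value, at the
   point with coordinates y in the chart c, on the tangent vectors with
   coordinates u and v. *)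
Definition form2 := chart R M m -> 'rV[R]_m -> 'rV[R]_m -> 'rV[R]_m -> R.

Definition is_form2 A (w : form2) : Prop :=
  [/\ forall c y u v r (a : R), A c -> cimg c y ->
        w c y (a *: u + v) r = a * w c y u r + w c y v r,
      forall c y u, A c -> cimg c y -> w c y u u = 0,
      forall c u v, A c -> Cinfty (cimg c) (fun y => w c y u v : R^o)
    & forall c c' x u v, A c -> A c' -> cdom c x -> cdom c' x ->
        let J r := 'D_r (cmap c' \o cinv c) (cmap c x) in
        w c' (cmap c' x) (J u) (J v) = w c (cmap c x) u v].

Definition closed_form2 A (w : form2) : Prop :=
  forall c y u v r, A c -> cimg c y ->
    'D_u (fun y' => w c y' v r : R^o) y + 'D_v (fun y' => w c y' r u : R^o) y
      + 'D_r (fun y' => w c y' u v : R^o) y = 0.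

Definition symplectic_form A (w : form2) : Prop :=
  [/\ is_form2 A w, closed_form2 A w
    & forall c y u, A c -> cimg c y -> (forall v, w c y u v = 0) -> u = 0].

(* w is nondegenerate on each tangent space of S (the restriction of w to the
   submanifold S is closed as soon as w is). *)
Definition symplectic_on A (w : form2) (S : set M) : Prop :=
  forall c x, A c -> cdom c x -> S x ->
    let TS := tangent (cmap c @` (cdom c `&` S)) (cmap c x) in
    forall u, TS u -> (forall v, TS v -> w c (cmap c x) u v = 0) -> u = 0.

End Manifold.

(* A torus is encoded by its underlying abelian group and its exponential map, a
   surjective homomorphism whose kernel is a lattice; its Lie group structure is
   the quotient one. *)
Record torus (R : realType) (n : nat) := Torus {
  lie : vectType R;
  tgroup : zmodType;
  texp : {additive lie -> tgroup};
  lie_dim : \dim {:lie} = n;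
  texp_surj : forall g, exists x, texp x = g;
  texp_ker : exists b : n.-tuple lie, basis_of {:lie} b /\
    forall x, texp x = 0 <->
      exists c : 'I_n -> int, x = \sum_(i < n) tnth b i *~ c i }.

Definition lattice {R : realType} {n : nat} (T : torus R n) : set (lie T) :=
  [set x | texp T x = 0].

Definition dual {R : realType} {n : nat} (T : torus R n) := 'Hom(lie T, R^o).

Definition pairing {R : realType} {n : nat} {T : torus R n}
  (x : lie T) (xi : dual T) : R := xi x.

Definition primitive {R : realType} {n : nat} {T : torus R n} (x : lie T) :=
  lattice x /\ forall (y : lie T) (k : nat), lattice y -> x = y *+ k -> k = 1%N.

Definition convex_polytope {R : realType} {W : lmodType R} (P : set W) : Prop :=
  exists (k : nat) (s : 'I_k -> W),
    P = [set xi | exists a : 'I_k -> R,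
          [/\ forall i, 0 <= a i, \sum_i a i = 1 & xi = \sum_i a i *: s i]].

(* Nonempty, with affine hull of dimension d. *)
Definition has_dim {R : realType} {W : vectType R} (P : set W) (d : nat) : Prop :=
  exists2 x0, P x0 & exists2 U : {vspace W}, \dim U = d &
    forall V : {vspace W}, (U <= V)%VS <-> (forall x, P x -> x - x0 \in V).

Definition is_face {R : realType} {n : nat} {T : torus R n}
    (P Q : set (dual T)) : Prop :=
  exists (x : lie T) (a : R), (forall xi, P xi -> 0 <= pairing x xi + a) /\
    Q = P `&` [set xi | pairing x xi + a = 0].

Definition is_facet {R : realType} {n : nat} {T : torus R n}
    (P Q : set (dual T)) : Prop :=
  is_face P Q /\ exists2 d, has_dim Q d & n = d.+1.

Definition is_vertex {R : realType} {n : nat} {T : torus R n}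
    (P : set (dual T)) (v : dual T) : Prop := is_face P [set v].

(* The codimension one faces are indexed bijectively by the finite type facets. *)
Record delzant {R : realType} {n : nat} (T : torus R n) := Delzant {
  polytope : set (dual T);
  facets : finType;
  facet : facets -> set (dual T);
  normal : facets -> lie T;
  offset : facets -> R;
  polytope_convex : convex_polytope polytope;
  polytope_dim : has_dim polytope n;
  facet_inj : injective facet;
  facet_all : forall Q, is_facet polytope Q <-> exists f, facet f = Q;
  normal_primitive : forall f, primitive (normal f);
  facet_eq0 : forall f xi, facet f xi -> pairing (normal f) xi + offset f = 0;
  polytope_ge0 : forall f xi, polytope xi ->
    0 <= pairing (normal f) xi + offset f;
  normal_basis : forall v, is_vertex polytope v ->
    forall x, lattice x ->
      exists! c : {ffun {f | v \in facet f} -> int},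
        x = \sum_f normal (val f) *~ c f }.

(* C^B for a finite type B, as a real normed space: the row of index b contains
   the real and imaginary parts of the coordinate z_b. *)
Notation cspace R B := 'M[R]_(#|B|, 2).

Definition re {R : realType} {B : finType} (z : cspace R B) (b : B) : R :=
  z (enum_rank b) ord0.
Definition im {R : realType} {B : finType} (z : cspace R B) (b : B) : R :=
  z (enum_rank b) ord_max.
Definition cvec {R : realType} {B : finType} (x y : B -> R) : cspace R B :=
  \matrix_(i, j) if j == ord0 then x (enum_val i) else y (enum_val i).

Lemma re_cvec {R : realType} {B : finType} (x y : B -> R) b :
  re (cvec x y) b = x b.
Proof. by rewrite /re mxE enum_rankK. Qed.

Lemma im_cvec {R : realType} {B : finType} (x y : B -> R) b :
  im (cvec x y) b = y b.
Proof. by rewrite /im mxE enum_rankK. Qed.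

Lemma cspaceP {R : realType} {B : finType} (z z' : cspace R B) :
  re z =1 re z' -> im z =1 im z' -> z = z'.
Proof.
move=> hr hi; apply/matrixP => i j.
have := hr (enum_val i); have := hi (enum_val i).
rewrite /re /im !enum_valK; case: j => -[|[|//]] p.
  by move=> _; rewrite (_ : Ordinal p = ord0)//; apply: val_inj.
by rewrite (_ : Ordinal p = ord_max)//; apply: val_inj.
Qed.

(* sigma = 1/(2 pi) sum_b dx_b /\ dy_b *)
Definition sigma {R : realType} {B : finType} (u v : cspace R B) : R :=
  (2 * pi)^-1 * \sum_b (re u b * im v b - im u b * re v b).

(* t . z, where (t . z)_b = exp(2 i pi t_b) z_b *)
Definition rot {R : realType} {B : finType} (t : {ffun B -> R})
    (z : cspace R B) : cspace R B :=
  cvec (fun b => cos (2 * pi * t b) * re z b - sin (2 * pi * t b) * im z b)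
       (fun b => sin (2 * pi * t b) * re z b + cos (2 * pi * t b) * im z b).

Definition moment {R : realType} {B : finType} (z : cspace R B) (b : B) : R :=
  (re z b ^+ 2 + im z b ^+ 2) / 2.

Lemma rot0 {R : realType} {B : finType} (z : cspace R B) : rot 0 z = z.
Proof.
by apply: cspaceP => b; rewrite ?re_cvec ?im_cvec !ffunE mulr0 cos0 sin0
  !mul0r !mul1r ?subr0 ?add0r.
Qed.

Lemma rotD {R : realType} {B : finType} (s t : {ffun B -> R}) (z : cspace R B) :
  rot (s + t) z = rot s (rot t z).
Proof.
apply: cspaceP => b; rewrite !(re_cvec, im_cvec) ffunE mulrDr cosD sinD; ring.
Qed.

Unset Implicit Arguments.

Section DelzantSpace.
Context {R : realType} {n : nat} {T : torus R n} (D : delzant T).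
Local Notation F := (facets D).

Definition projF (t : {ffun F -> R}) : lie T := \sum_f t f *: normal f.

(* The inverse image in R^F of the subgroup N of R^F/Z^F. *)
Definition groupN : set {ffun F -> R} := [set t | texp T (projF t) = 0].

Definition lie_n : set {ffun F -> R} := [set t | projF t = 0].

(* mu_N(z) = lambda_N, as linear forms on lie_n *)
Definition levelZ : set (cspace R F) :=
  [set z | forall t, lie_n t ->
     \sum_f moment z f * t f = \sum_f offset f * t f].

Definition rad (f : F) (xi : dual T) : R :=
  Num.sqrt (2 * (pairing (normal f) xi + offset f)).

Lemma projFD s t : projF (s + t) = projF s + projF t.
Proof.
by rewrite -big_split; apply: eq_bigr => f _; rewrite ffunE scalerDl.
Qed.

Lemma levelZ_nonempty : exists z, levelZ z.
Proof.
have [xi Pxi _] := polytope_dim D.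
exists (cvec (rad^~ xi) (fun=> 0)) => t /= t0.
have momE f : moment (cvec (rad^~ xi) (fun=> 0)) f =
    pairing (normal f) xi + offset f.
  rewrite /moment re_cvec im_cvec expr0n addr0 sqr_sqrtr ?mulr_ge0//.
    by rewrite mulrAC mulfV ?mul1r// pnatr_eq0.
  exact: polytope_ge0.
under eq_bigr do rewrite momE mulrDl.
rewrite big_split /= -[RHS]add0r; congr (_ + _).
transitivity (xi (projF t)); last by rewrite t0 linear0.
rewrite linear_sum; apply: eq_bigr => f _.
by rewrite linearZ /= mulrC.
Qed.

Definition orbit_rel (z z' : levelZ) : bool :=
  `[< exists2 t, groupN t & val z' = rot t (val z) >].

Lemma orbit_rel_equiv : equiv_class_of orbit_rel.
Proof.
split.
- move=> z; apply/asboolP; exists 0; last by rewrite rot0.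
  have : projF 0 + projF 0 = projF 0 by rewrite -projFD addr0.
  by move/eqP; rewrite -subr_eq0 addrK /groupN /= => /eqP ->; rewrite raddf0.
- suff sym z z' : orbit_rel z z' -> orbit_rel z' z.
    by move=> z z'; apply/idP/idP; exact: sym.
  move=> /asboolP[t Nt zt]; apply/asboolP; exists (- t); last first.
    by rewrite zt -rotD addNr rot0.
  rewrite /groupN /= (_ : projF (- t) = - projF t) ?raddfN ?Nt ?oppr0//.
  by rewrite -sumrN; apply: eq_bigr => f _; rewrite ffunE scaleNr.
- move=> z2 z1 z3 /asboolP[s Ns zs] /asboolP[t Nt zt]; apply/asboolP.
  exists (t + s); last by rewrite rotD -zs.
  by rewrite /groupN /= projFD raddfD Nt Ns addr0.
Qed.

Definition orbit_equiv := EquivRelPack orbit_rel_equiv.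

(* M = Z/N, with the quotient of the subspace topology of Z. *)
Definition delzant_space := quotient_topology {eq_quot orbit_equiv}.

HB.instance Definition _ := Topological.copy delzant_space
  (quotient_topology {eq_quot orbit_equiv}).

Definition base_point : levelZ :=
  exist _ (sval (cid levelZ_nonempty)) (mem_set (svalP (cid levelZ_nonempty))).

(* The projection p : Z -> M, with a dummy value outside Z. *)
Definition projM (z : cspace R F) : delzant_space :=
  \pi_(delzant_space) (insubd base_point z).

(* The smooth structure of M as the quotient of Z: a chart is smooth when its
   composition with p is smooth and its inverse has local smooth lifts to Z. *)
Definition delzant_atlas : atlas R delzant_space (2 * n) :=
  [set c | [/\ is_chart c,
     smooth_on (levelZ `&` projM @^-1` cdom c) (cmap c \o projM)
   & forall y, cimg c y -> exists O : set 'rV[R]_(2 * n),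
       exists s : 'rV[R]_(2 * n) -> cspace R F,
       [/\ open O, O y /\ O `<=` cimg c, Cinfty O s, s @` O `<=` levelZ
         & {in O, projM \o s =1 cinv c}]]].

(* The pull-back of w by p is the restriction of sigma to Z; tangent vectors to Z
   are represented by smooth curves. *)
Definition pullback_eq (w : @form2 R delzant_space (2 * n)) : Prop :=
  forall c z g h, delzant_atlas c -> cdom c (projM z) ->
    curve_at levelZ z g -> curve_at levelZ z h ->
    w c (cmap c (projM z)) ('D_1 (cmap c \o projM \o g) (0 : R^o))
                           ('D_1 (cmap c \o projM \o h) (0 : R^o))
    = sigma ('D_1 g (0 : R^o)) ('D_1 h (0 : R^o)).

(* The momentum map: the unique xi with pi^* xi = mu(z) - lambda, for z over m. *)
Definition moment_T (m : delzant_space) : dual T :=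
  xget (0 : dual T) [set xi | forall z, levelZ z -> projM z = m ->
    forall t, xi (projF t) = \sum_f (moment z f - offset f) * t f].

Definition facets_at (v : dual T) : finType := {f : F | v \in facet f}.

Definition rho (v : dual T) (z : cspace R F) : cspace R (facets_at v) :=
  cvec (fun f => re z (val f)) (fun f => im z (val f)).

Definition domU (v : dual T) : set (cspace R (facets_at v)) :=
  interior (rho v @` levelZ).

Definition levelZ_at (v : dual T) : set (cspace R F) :=
  rho v @^-1` domU v `&` levelZ.

Definition delzant_space_at (v : dual T) : set delzant_space :=
  projM @` levelZ_at v.

Definition moment_at (v : dual T) (z : cspace R (facets_at v)) : dual T :=
  xget (0 : dual T) [set xi | forall f : facets_at v,
    moment z f - offset (val f) = pairing (normal (val f)) xi].

Definition section_at (v : dual T) (z : cspace R (facets_at v)) : cspace R F :=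
  cvec (fun f => if insub f is Some f' then re z f'
                 else rad f (moment_at v z))
       (fun f => if insub f is Some f' then im z f' else 0).

Definition psi (v : dual T) : cspace R (facets_at v) -> delzant_space :=
  projM \o section_at v.

End DelzantSpace.

(* Main.v *)
Require Import Defs.
From HB Require Import structures.
From mathcomp Require Import all_boot all_order all_algebra.
From mathcomp Require Import all_classical all_reals all_analysis.
From mathcomp Require Import perm complex ring lra zify.
Import Defs.
Set Implicit Arguments.
Unset Strict Implicit.
Unset Printing Implicit Defensive.
Import Order.TTheory GRing.Theory Num.Theory.
Import numFieldNormedType.Exports.
Local Open Scope classical_set_scope.
Local Open Scope ring_scope.

(** Write h_f(xi) = <X_f, xi> + lambda_f. A point z lies in Z exactly when some xi in
   the dual has |z_f|^2 / 2 = h_f(xi) for all f (levelZP), and xi is then the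
   momentum of the orbit of z. So Z consists of the points
   z_f = sqrt(2 h_f(xi)) exp(2 pi i t_f), with xi in the polytope and t arbitrary.

   Convex geometry. The polytope is given as a convex hull, and its faces by
   supporting affine functions. A point outside it is separated from it by a facet
   (polytope_halfspaces): a separating affine function that vanishes on as many
   generating points as possible vanishes on a facet. Every point xi of the
   polytope has a vertex v lying on all the facets through xi (vertex_below). At a
   vertex v, the normals of the facets through v form a real basis of the Lie
   algebra in which the other normals have integral coordinates.

   Charts. The set U_v is defined by the inequalities h_g(mu_v(u)) > 0 for the facets
   g that do not contain v (domUE): along a ray, h_g has the form a s^2 + b with
   b = h_g(v) > 0, so it becomes negative right after a zero. The inverse of psi_v
   comes from the map normal_form on Z_v, which divides out the phases of the
   coordinates z_g away from v, compensating in the coordinates at v by integral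
   powers of these phases: it is invariant under N and smooth on an open set of
   C^F. Hence psi_v^-1 is a chart of the atlas (vertex_chart_atlas) and psi_v is a
   diffeomorphism (psi_diffeo).

   Maximality. Moving the momentum towards a point interior to the polytope makes
   all the coordinates nonzero, so M_v is dense. A diffeomorphism extending psi_v
   is open and injective, so by density U_v is dense in its domain; that domain is
   thus an open subset of the compact set rho_v(Z), and is contained in its
   interior U_v (psi_maximal).

   Facets. The preimage of the facet f is the image of the points of Z with z_f = 0.
   These form a closed subset of the compact set Z, and any two of them are joined
   by a path in polar coordinates above a segment of the facet. In the chart at a
   vertex of f, the preimage is the linear subspace z_f = 0, of codimension 2.

   Symplecticity. Let u be tangent to the preimage of f and orthogonal to all the
   vectors tangent to it, and r any vector tangent to M. Lift u and r to curves of
   Z. The second curve is deformed into one with z_f = 0, with the same derivative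
   except for the coordinate z_f (derive_deformed), since |z_f|^2 vanishes to
   second order at time 0. As the derivative of the first curve vanishes at f, this
   does not change the value of sigma. So u is orthogonal to r too, and u = 0 by
   nondegeneracy on M. *)

(** * Smooth maps between finite-dimensional spaces *)

Section Smooth.
Context {R : realType}.

Lemma near_eq_differentiable (E E' : normedModType R) (f g : E -> E') x :
  (\near x, f x = g x) -> differentiable f x -> differentiable g x.
Proof.
move=> fg df.
suff : differentiable (g - f) x.
  by move=> dh; rewrite -(subrK f g); exact: differentiableD.
have hx : g x - f x = 0 by rewrite (nbhs_singleton fg) subrr.
have eqo : (g - f) \o shift x = cst ((g - f) x) + (0 : E -> E') +o_ (0 : E) id.
  apply/eqaddoP => _/posnumP[e].
  rewrite near_simpl; move: fg; rewrite (near_shift 0 x) /= => fg.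
  near=> y.
  have fgy : f (y + x) = g (y + x).
    by near: y; apply: filterS fg => y /=; rewrite subr0.
  rewrite !fctE /= ?fctE hx fgy subrr addr0 subr0 normr0; exact: mulr_ge0.
have d0 : 'd (g - f) x = 0 :> (E -> E').
  by apply: (diff_unique (df := \0)) eqo; exact: cst_continuous.
by apply/diff_locallyP; rewrite d0; split=> //; exact: cst_continuous.
Unshelve. all: by end_near. Qed.

(** Since the derivatives in Ck are those of the ambient space, the values of f on
   O determine its class there only because O is open. *)
Lemma Ck_eq (E E' : normedModType R) k (O : set E) (f g : E -> E') :
  open O -> (forall x, O x -> f x = g x) -> Ck k O f -> Ck k O g.
Proof.
move=> oO; elim: k f g => [|k IH] f g fg /=.
  move=> cf x Ox; have fgx : \near x, f x = g x.
    by near=> y; apply: fg; near: y; exact: open_nbhs_nbhs.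
  rewrite /prop_for /continuous_at -(fg x Ox).
  apply: cvg_trans (cf x Ox); apply: near_eq_cvg; exact: fgx.
move=> [df Df]; split.
  move=> x Ox; apply: near_eq_differentiable (df x Ox).
  by near=> y; apply: fg; near: y; exact: open_nbhs_nbhs.
move=> v; apply: IH (Df v) => x Ox.
apply: near_eq_derive.
by near=> y; apply: fg; near: y; exact: open_nbhs_nbhs.
Unshelve. all: by end_near. Qed.

Lemma Ck_sub (E E' : normedModType R) k (O O' : set E) (f : E -> E') :
  O' `<=` O -> Ck k O f -> Ck k O' f.
Proof.
move=> sub; elim: k f => [|k IH] f /=; first by move=> cf x /sub; exact: cf.
by move=> [df Df]; split=> [x /sub|v]; [exact: df|exact: IH].
Qed.

Lemma Ck_pred (E E' : normedModType R) k (O : set E) (f : E -> E') :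
  Ck k.+1 O f -> Ck k O f.
Proof.
elim: k f => [|k IH] f; last first.
  by move=> [df Df]; split=> // v; exact: IH.
by move=> [df _] x Ox; apply: differentiable_continuous; exact: df.
Qed.

Lemma Ck_differentiable (E E' : normedModType R) k (O : set E) (f : E -> E') x :
  Ck k.+1 O f -> O x -> differentiable f x.
Proof. by move=> [df _]; exact: df. Qed.

Lemma Ck_derivable (E E' : normedModType R) k (O : set E) (f : E -> E') x v :
  Ck k.+1 O f -> O x -> derivable f x v.
Proof. by move=> [df _] Ox; apply: diff_derivable; exact: df. Qed.

Lemma Ck_cst (E E' : normedModType R) k (O : set E) (a : E') :
  Ck k O (fun _ : E => a).
Proof.
elim: k a => [|k IH] a /=; first by move=> x _; exact: cst_continuous.
split=> [x _|v]; first exact: differentiable_cst.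
rewrite (_ : (fun x : E => 'D_v (fun=> a) x) = fun=> 0); first exact: IH.
by apply/funext => x; exact: derive_cst.
Qed.

Lemma Ck_linear (E E' : normedModType R) k (O : set E) (f : {linear E -> E'}) :
  continuous f -> Ck k O f.
Proof.
move=> cf; case: k => [|k] /=; first by move=> x _; exact: cf.
split=> [x _|v]; first exact: linear_differentiable.
rewrite (_ : (fun x : E => 'D_v f x) = fun=> f v); first exact: Ck_cst.
apply/funext => x; rewrite deriveE; last exact: linear_differentiable.
by rewrite diff_lin.
Qed.

Lemma Ck_add (E E' : normedModType R) k (O : set E) (f g : E -> E') :
  open O -> Ck k O f -> Ck k O g -> Ck k O (fun x => f x + g x).
Proof.
move=> oO; elim: k f g => [|k IH] f g.
  by move=> cf cg x Ox; apply: cvgD; [exact: cf|exact: cg].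
move=> Cf Cg; split=> [x Ox|v].
  by apply: differentiableD; [exact: Ck_differentiable Cf Ox|
                              exact: Ck_differentiable Cg Ox].
apply: (Ck_eq oO _ (IH _ _ (Cf.2 v) (Cg.2 v))) => x Ox.
by apply/esym/deriveD; [exact: Ck_derivable Cf Ox|exact: Ck_derivable Cg Ox].
Qed.

Lemma Ck_sum (E E' : normedModType R) (I : Type) (s : seq I) (P : pred I) k
    (O : set E) (f : I -> E -> E') : open O -> (forall i, P i -> Ck k O (f i)) ->
  Ck k O (fun x => \sum_(i <- s | P i) f i x).
Proof.
move=> oO Cf; elim: s => [|i s IH].
  by under eq_fun do rewrite big_nil; exact: Ck_cst.
under eq_fun do rewrite big_cons.
by case Pi : (P i) => //; apply: Ck_add => //; exact: Cf.
Qed.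

Lemma Ck_mul (E : normedModType R) k (O : set E) (f g : E -> R^o) :
  open O -> Ck k O f -> Ck k O g -> Ck k O (fun x => f x * g x : R^o).
Proof.
move=> oO; elim: k f g => [|k IH] f g.
  by move=> cf cg x Ox; apply: cvgM; [exact: cf|exact: cg].
move=> Cf Cg; split=> [x Ox|v].
  by apply: differentiableM; [exact: Ck_differentiable Cf Ox|
                              exact: Ck_differentiable Cg Ox].
have h1 := IH _ _ (Ck_pred Cf) (Cg.2 v).
have h2 := IH _ _ (Ck_pred Cg) (Cf.2 v).
apply: (Ck_eq oO _ (Ck_add oO h1 h2)) => x Ox.
by apply/esym/deriveM; [exact: Ck_derivable Cf Ox|exact: Ck_derivable Cg Ox].
Qed.

Lemma Ck_opp (E : normedModType R) k (O : set E) (f : E -> R^o) :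
  open O -> Ck k O f -> Ck k O (fun x => - f x : R^o).
Proof.
move=> oO Cf; apply: (Ck_eq oO _ (Ck_mul oO (@Ck_cst _ _ k O (-1 : R^o)) Cf)).
by move=> x _; rewrite mulN1r.
Qed.

Lemma Ck_inv (E : normedModType R) k (O : set E) (f : E -> R^o) :
  open O -> (forall x, O x -> f x != 0) -> Ck k O f ->
  Ck k O (fun x => (f x)^-1 : R^o).
Proof.
move=> oO f0; elim: k f f0 => [|k IH] f f0.
  by move=> cf x Ox; apply: cvgV; [exact: f0|exact: cf].
move=> Cf; split=> [x Ox|v].
  by apply: differentiableV; [exact: Ck_differentiable Cf Ox|exact: f0].
have h := IH _ f0 (Ck_pred Cf).
apply: (Ck_eq oO _ (Ck_opp oO (Ck_mul oO (Ck_mul oO h h) (Cf.2 v)))) => x Ox.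
rewrite deriveV; [|exact: f0|exact: Ck_derivable Cf Ox].
by rewrite -invfM -expr2 scaleNr.
Qed.

Lemma derive_comp_sqrt (E : normedModType R) (f : E -> R^o) x v :
  differentiable f x -> 0 < f x ->
  differentiable (fun y => Num.sqrt (f y) : R^o) x /\
  'D_v (fun y => Num.sqrt (f y) : R^o) x = (2 * Num.sqrt (f x))^-1 * 'D_v f x.
Proof.
move=> df f0; have dsqrt : differentiable (Num.sqrt : R^o -> R^o) (f x).
  by apply/derivable1_diffP; apply: ex_derive; exact: is_derive1_sqrt.
have dc : differentiable ((Num.sqrt : R^o -> R^o) \o f) x.
  exact: differentiable_comp.
split=> //; rewrite deriveE// -/((Num.sqrt : R^o -> R^o) \o f) diff_comp//=.
rewrite (deriveE v)// diff1E// derive1E derive_sqrt//.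
exact: mulrC.
Qed.

Lemma Ck_sqrt (E : normedModType R) k (O : set E) (f : E -> R^o) :
  open O -> (forall x, O x -> 0 < f x) -> Ck k O f ->
  Ck k O (fun x => Num.sqrt (f x) : R^o).
Proof.
move=> oO f0; elim: k f f0 => [|k IH] f f0.
  move=> cf x Ox; apply: continuous_comp; [exact: cf|exact: sqrt_continuous].
move=> Cf; split=> [x Ox|v].
  by have [] := derive_comp_sqrt 0 (Ck_differentiable Cf Ox) (f0 _ Ox).
have h := Ck_mul oO (@Ck_cst _ _ k O (2 : R^o)) (IH _ f0 (Ck_pred Cf)).
apply: (Ck_eq oO _ (Ck_mul oO (Ck_inv oO _ h) (Cf.2 v))) => x Ox.
  by have [_ ->] := derive_comp_sqrt v (Ck_differentiable Cf Ox) (f0 _ Ox).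
by rewrite mulf_neq0// ?pnatr_eq0// gt_eqF// sqrtr_gt0 f0.
Qed.

Lemma Ck_coord (E : normedModType R) k (O : set E) p q (f : E -> 'M[R]_(p, q)) i j :
  open O -> Ck k O f -> Ck k O (fun x => f x i j : R^o).
Proof.
move=> oO; elim: k f => [|k IH] f.
  move=> cf x Ox.
  apply: (@continuous_comp _ _ _ f (fun M : 'M[R]_(p, q) => M i j : R^o)).
    exact: cf.
  exact: coord_continuous.
move=> Cf; split=> [x Ox|v].
  have := differentiable_coord (f x) i j.
  move/(differentiable_comp (Ck_differentiable Cf Ox)); exact.
apply: (Ck_eq oO _ (IH _ (Cf.2 v))) => x Ox.
by rewrite derive_mx ?mxE//; exact: Ck_derivable Cf Ox.
Qed.

Lemma Ck_mx (E : normedModType R) k (O : set E) p q (f : E -> 'M[R]_(p, q)) :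
  open O -> (forall i j, Ck k O (fun x => f x i j : R^o)) -> Ck k O f.
Proof.
move=> oO; elim: k f => [|k IH] f Cf.
  move=> x Ox; apply/cvgrPdist_le => e e0; near=> y.
  rewrite /Num.Def.normr/= mx_normrE (bigmax_le _ (ltW e0))//= => i _.
  rewrite !mxE/=.
  move: i; near: y; apply: filter_forall => /= i.
  exact: ((cvgrPdist_le _ _).1 (Cf i.1 i.2 x Ox)).
have dZ (w : 'M[R]_(p, q)) (h : E -> R^o) x : differentiable h x ->
    differentiable (fun y => h y *: w) x.
  by move=> dh; exact: differentiableZl.
split=> [x Ox|v].
  have -> : f = fun x => \sum_i \sum_j f x i j *: delta_mx i j.
    by apply/funext => y; exact: matrix_sum_delta.
  have ds (I : Type) (s : seq I) (h : I -> E -> 'M[R]_(p, q)) :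
      (forall i, differentiable (h i) x) ->
      differentiable (fun y => \sum_(i <- s) h i y) x.
    move=> dh; elim: s => [|i s IHs].
      by under eq_fun do rewrite big_nil; exact: differentiable_cst.
    by under eq_fun do rewrite big_cons; exact: differentiableD.
  apply: (ds) => i; apply: (ds) => j; apply: dZ.
  exact: Ck_differentiable (Cf i j) Ox.
have Df x : O x -> 'D_v f x = \matrix_(i, j) 'D_v (fun t => f t i j) x.
  move=> Ox; apply: derive_mx; apply/derivable_mxP => i j.
  exact: Ck_derivable (Cf i j) Ox.
apply: (Ck_eq oO (fun x Ox => esym (Df x Ox))); apply: IH => i j.
by under eq_fun do rewrite mxE; exact: (Cf i j).2.
Unshelve. all: by end_near. Qed.

(** The chain rule expresses the derivatives of a composition by products of
   derivatives of the factors, of the same order: whence an induction on k. *)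
Lemma Ck_comp (E : normedModType R) p q k (O : set E) (O' : set 'M[R]_(p, q))
    (f : E -> 'M[R]_(p, q)) (g : 'M[R]_(p, q) -> R^o) :
  open O -> open O' -> (forall x, O x -> O' (f x)) ->
  Ck k O f -> Ck k O' g -> Ck k O (g \o f).
Proof.
move=> oO oO' sub; elim: k f g sub => [|k IH] f g sub.
  by move=> cf cg x Ox; apply: continuous_comp; [exact: cf|exact/cg/sub].
move=> Cf Cg.
have dg x : O x -> differentiable g (f x) by move=> /sub; exact: Ck_differentiable Cg.
have df x : O x -> differentiable f x by exact: Ck_differentiable Cf.
split=> [x Ox|v]; first by apply: differentiable_comp; [exact: df|exact: dg].
have chain x : O x -> 'D_v (g \o f) x =
   \sum_i \sum_j 'D_v f x i j * 'D_(delta_mx i j) g (f x).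
  move=> Ox; rewrite deriveE; last by apply: differentiable_comp; [exact: df|exact: dg].
  have := diff_comp (df x Ox) (dg x Ox) => /(congr1 (fun h => h v)) /= ->.
  rewrite -(deriveE _ (df x Ox)).
  rewrite [in LHS](matrix_sum_delta ('D_v f x)) linear_sum/=.
  apply: eq_bigr => i _; rewrite linear_sum/=; apply: eq_bigr => j _.
  by rewrite linearZ/= -(deriveE _ (dg x Ox)).
apply: (Ck_eq oO (fun x Ox => esym (chain x Ox))).
apply: Ck_sum => // i _; apply: Ck_sum => // j _; apply: Ck_mul => //.
  exact: Ck_coord (Cf.2 v).
by apply: IH (Cg.2 _) => //; exact: Ck_pred.
Qed.

Lemma Ck_comp_mx (E : normedModType R) p q p' q' k (U : set E) (U' : set 'M[R]_(p, q))
    (h : E -> 'M[R]_(p, q)) (g : 'M[R]_(p, q) -> 'M[R]_(p', q')) :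
  open U -> open U' -> (forall x, U x -> U' (h x)) ->
  Ck k U h -> Ck k U' g -> Ck k U (g \o h).
Proof.
move=> oU oU' sub Ch Cg; apply: Ck_mx => // i j.
apply: (Ck_comp (g := fun y => g y i j) oU oU' sub Ch).
exact: Ck_coord.
Qed.

End Smooth.

(** * Linear inequalities *)

(** The affine functions a i + t * b i are nonnegative at time 0; the time sought
   is the smallest of the ratios a i / - b i over the decreasing ones. *)
Lemma first_hit (R : realFieldType) (I : finType) (a b : I -> R) (j : I) :
  (forall i, 0 <= a i) -> (forall i, b i < 0 -> 0 < a i) -> b j < 0 ->
  exists2 t, 0 < t & (forall i, 0 <= a i + t * b i) /\
                     exists2 i, b i < 0 & a i + t * b i = 0.
Proof.
move=> a0 ab bj.
case: (@Order.TotalTheory.arg_minP _ _ _ j (fun i => b i < 0) (fun i => a i / - b i) bj).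
move=> i bi mini; exists (a i / - b i).
  by rewrite divr_gt0 ?oppr_gt0// ab.
split=> [k|]; last first.
  by exists i => //; rewrite invrN mulrN mulNr divfK ?subrr// lt_eqF.
have [bk|bk] := ltP (b k) 0; last first.
  by rewrite addr_ge0// mulr_ge0// divr_ge0// oppr_ge0 ltW.
have := mini _ bk; rewrite ler_pdivlMr ?oppr_gt0// mulrN.
by rewrite lerNl -subr_ge0 opprK addrC.
Qed.

Section Farkas.
Context {R : realFieldType} {C V : lmodType R} (B : C -> V -> R).
Context (BDl : forall s c c' v, B (c + s *: c') v = B c v + s * B c' v).
Context (BDr : forall s c v v', B c (v + s *: v') = B c v + s * B c v').
Context (Bnd : forall v, v != 0 -> exists c, B c v != 0).

Lemma pair0 c : B c 0 = 0.
Proof.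
have := BDr 1 c 0 0; rewrite scaler0 addr0 mul1r => /eqP.
by rewrite -subr_eq0 opprD addNKr oppr_eq0 => /eqP.
Qed.

Lemma pairNl c v : B (- c) v = - B c v.
Proof.
have B0 : B 0 v = 0.
  have := BDl 1 0 0 v; rewrite scaler0 addr0 mul1r => /eqP.
  by rewrite -subr_eq0 opprD addNKr oppr_eq0 => /eqP.
by rewrite -[- c]add0r -scaleN1r BDl B0 add0r mulN1r.
Qed.

(** Induction on the number of generators: when the functional separating b from
   the cone of the other generators is negative on the last generator, project
   all the vectors along that generator onto the kernel of the functional. *)
Lemma farkas k (a : 'I_k -> V) (b : V) :
  (forall y : 'I_k -> R, (forall i, 0 <= y i) -> b <> \sum_i y i *: a i) ->
  exists c, (forall i, 0 <= B c (a i)) /\ B c b < 0.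
Proof.
elim: k a b => [|k IH] a b.
  move=> /(_ (fun=> 0)); rewrite big_ord0 => /(_ (fun=> lexx _)) /eqP b0.
  have [c] := Bnd b0; rewrite neq_lt => /orP[cb|cb].
    by exists c; split=> // -[].
  by exists (- c); rewrite pairNl oppr_lt0; split=> // -[].
move=> nb; have [c [ca cb]] : exists c, (forall i, 0 <= B c (a (lift ord0 i))) /\ B c b < 0.
  apply: IH => y y0 bE; apply: (nb (fun i => oapp y 0 (unlift ord0 i))).
    by move=> i; case: unliftP => [j|] _ /=; [exact: y0|].
  rewrite big_ord_recl unlift_none scale0r add0r bE.
  by apply: eq_bigr => i _; rewrite liftK.
have [c0|c0] := leP 0 (B c (a ord0)).
  exists c; split=> // i; case: (unliftP ord0 i) => [j|] -> //.
set q := fun v => v - (B c v / B c (a ord0)) *: a ord0.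
have [c' [c'a c'b]] : exists c', (forall i, 0 <= B c' (q (a (lift ord0 i)))) /\ B c' (q b) < 0.
  apply: IH => y y0 bE.
  apply: (nb (fun i => oapp y
      (B c b / B c (a ord0) - \sum_j y j * (B c (a (lift ord0 j)) / B c (a ord0)))
      (unlift ord0 i))).
    move=> i; case: unliftP => [j|] _ /=; first exact: y0.
    rewrite subr_ge0 (@le_trans _ _ 0)//.
      rewrite -oppr_ge0 -sumrN sumr_ge0// => j _.
      by rewrite -mulrN -mulrN -invrN mulr_ge0// divr_ge0// oppr_ge0 ltW.
    by rewrite -mulrNN -invrN divr_ge0// oppr_ge0 ltW.
  rewrite big_ord_recl unlift_none /= scalerBl.
  rewrite [LHS](_ : b = (B c b / B c (a ord0)) *: a ord0 + q b); last first.
    by rewrite /q addrC subrK.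
  rewrite bE -addrA; congr (_ + _).
  rewrite scaler_suml -sumrN -big_split/=.
  by apply: eq_bigr => i _; rewrite liftK /q scalerBr scalerA addrC.
have Bq v : B (c' + (- (B c' (a ord0) / B c (a ord0))) *: c) v = B c' (q v).
  by rewrite BDl /q -(scaleNr _ (a ord0)) BDr; ring.
exists (c' + (- (B c' (a ord0) / B c (a ord0))) *: c); split=> [i|]; last by rewrite Bq.
case: (unliftP ord0 i) => [j|] ->; first by rewrite Bq.
rewrite Bq (_ : q (a ord0) = 0) ?pair0//.
by rewrite /q divff ?scale1r ?subrr// lt_eqF.
Qed.

(** Take a separating functional with as many tight generators as possible: any
   nonzero functional vanishing on these and at b could be added to it, up to a
   factor, until one more generator gets tight. *)
Lemma rigid_separation k (a : 'I_k -> V) (b : V) :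
  (forall d, (forall i, B d (a i) = 0) -> d = 0) ->
  (forall y : 'I_k -> R, (forall i, 0 <= y i) -> b <> \sum_i y i *: a i) ->
  exists c, [/\ forall i, 0 <= B c (a i), B c b < 0 &
    forall d, (forall i, B c (a i) = 0 -> B d (a i) = 0) -> B d b = 0 -> d = 0].
Proof.
move=> span /farkas[c [ca cb]].
(* Induction on the number of generators that are not tight. *)
move: {2}#|_|.+1 (ltnSn #|[pred i | B c (a i) != 0]|) => m.
elim: m c ca cb => // m IH c ca cb lem.
apply: contrapT => nex.
have [d [dt db d0]] : exists d, [/\ forall i, B c (a i) = 0 -> B d (a i) = 0,
    B d b = 0 & d != 0].
  apply: contrapT => nd; apply: nex; exists c; split=> // d dt db.
  by apply/eqP/negP => /negP d0; apply: nd; exists d.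
have [j dj] : exists j, B d (a j) != 0.
  apply: contrapT => nj; move/eqP: d0; apply; apply: span => i.
  by apply/eqP/negP => /negP ?; apply: nj; exists i.
wlog dj0 : d dt db d0 dj / B d (a j) < 0.
  move=> H; have [|dj1] := ltP (B d (a j)) 0; first exact: (H d).
  apply: (H (- d)); rewrite ?pairNl ?oppr_eq0 ?db ?oppr0 ?oppr_lt0 ?lt_def ?dj//.
  by move=> i /dt; rewrite pairNl => ->; rewrite oppr0.
have cd i : B d (a i) < 0 -> 0 < B c (a i).
  by move=> di; rewrite lt_def ca andbT; apply/eqP => /dt e; move: di; rewrite e ltxx.
have [t t0 [tge [i di ti]]] := first_hit ca cd dj0.
apply: nex; apply: (IH (c + t *: d)).
- by move=> l; rewrite BDl.
- by rewrite BDl db mulr0 addr0.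
rewrite ltnS in lem; apply: leq_trans lem; apply: proper_card; apply/properP; split.
  apply/fintype.subsetP => l; rewrite !inE; apply: contraNN => /eqP cl.
  by rewrite BDl cl dt// mulr0 addr0.
exists i; rewrite !inE ?BDl ?ti ?eqxx//.
by apply/eqP => /dt e; move: di; rewrite e ltxx.
Qed.

End Farkas.

(** * Linear forms on the dual of the Lie algebra *)

Section Dual.
Context {R : realType} {n : nat} {T : torus R n}.
Local Notation L := (lie T).
Local Notation W := (dual T).
Implicit Types (x : L) (xi : W).

Lemma pairingDl x y xi : pairing (x + y) xi = pairing x xi + pairing y xi.
Proof. exact: linearD. Qed.
Lemma pairingZl s x xi : pairing (s *: x) xi = s * pairing x xi.
Proof. exact: linearZ. Qed.
Lemma pairingNl x xi : pairing (- x) xi = - pairing x xi.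
Proof. exact: linearN. Qed.
Lemma pairingBl x y xi : pairing (x - y) xi = pairing x xi - pairing y xi.
Proof. exact: linearB. Qed.
Lemma pairing0l xi : pairing (0 : L) xi = 0.
Proof. exact: linear0. Qed.
Lemma pairing_suml (I : Type) (s : seq I) (P : pred I) (f : I -> L) xi :
  pairing (\sum_(i <- s | P i) f i) xi = \sum_(i <- s | P i) pairing (f i) xi.
Proof. exact: linear_sum. Qed.
Lemma pairingDr x xi xi' : pairing x (xi + xi') = pairing x xi + pairing x xi'.
Proof. exact: add_lfunE. Qed.
Lemma pairingZr s x xi : pairing x (s *: xi) = s * pairing x xi.
Proof. exact: scale_lfunE. Qed.
Lemma pairingNr x xi : pairing x (- xi) = - pairing x xi.
Proof. exact: opp_lfunE. Qed.
Lemma pairingBr x xi xi' : pairing x (xi - xi') = pairing x xi - pairing x xi'.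
Proof. by rewrite pairingDr pairingNr. Qed.
Lemma pairing0r x : pairing x (0 : W) = 0.
Proof. exact: zero_lfunE. Qed.
Lemma pairing_sumr (I : Type) (s : seq I) (P : pred I) (f : I -> W) x :
  pairing x (\sum_(i <- s | P i) f i) = \sum_(i <- s | P i) pairing x (f i).
Proof. exact: sum_lfunE. Qed.

Lemma pairing_ext xi xi' : (forall x, pairing x xi = pairing x xi') -> xi = xi'.
Proof. by move=> h; apply/lfunP. Qed.

Lemma dim_dual : \dim {:W} = n.
Proof. by have := lie_dim T; rewrite !dimvf /dim/= muln1. Qed.

Lemma pairing_neq0 x : x != 0 -> exists xi, pairing x xi != 0.
Proof.
move=> x0; apply: contrapT => nex.
have cx i : coord (vbasis {:L}) i x = 0.
  apply/eqP/negP => /negP ci; apply: nex.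
  by exists (linfun (coord (vbasis {:L}) i : L -> R^o)); rewrite /pairing lfunE.
move/eqP: x0; apply; rewrite (coord_vbasis (memvf x)) big1// => i _.
by rewrite cx scale0r.
Qed.

Definition ev x : 'Hom(W, R^o) := linfun (pairing x : W -> R^o).

Lemma pairing_is_linear x : linear (pairing x : W -> R^o).
Proof. by move=> s xi xi'; rewrite pairingDr pairingZr. Qed.
HB.instance Definition _ x :=
  GRing.isLinear.Build R W R^o *:%R (pairing x : W -> R^o) (pairing_is_linear x).

Lemma evE x xi : ev x xi = pairing x xi. Proof. exact: lfunE. Qed.

Lemma mem_lker_ev x xi : (xi \in lker (ev x)) = (pairing x xi == 0).
Proof. by rewrite memv_ker evE. Qed.

Lemma dim_lker_ev x : x != 0 -> (\dim (lker (ev x))).+1 = n.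
Proof.
move=> /pairing_neq0[xi xi0]; apply: etrans dim_dual; rewrite -(limg_ker_dim (ev x) fullv) capfv.
suff -> : (ev x @: fullv)%VS = fullv by rewrite [\dim {:R^o}]dimvf /dim/= addn1.
apply/eqP; rewrite eqEsubv subvf /=; apply/subvP => r _.
have -> : r = ev x ((r / pairing x xi) *: xi).
  by rewrite evE pairingZr divfK.
exact/memv_img/memvf.
Qed.

(** Subtracting from a vector a multiple of some w with pairing x w <> 0 brings it
   into the kernel of x. *)
Lemma proportional x y : x != 0 ->
  (forall xi, pairing x xi = 0 -> pairing y xi = 0) ->
  exists k, y = k *: x.
Proof.
move=> /pairing_neq0[w w0] H; exists (pairing y w / pairing x w).
apply/eqP; rewrite -subr_eq0; apply: contrapT => /negP /pairing_neq0[xi].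
rewrite pairingBl pairingZl.
have := H (xi - (pairing x xi / pairing x w) *: w).
rewrite !pairingBr !pairingZr divfK// subrr => /(_ erefl) /eqP.
rewrite subr_eq0 => /eqP ->; move/eqP; apply; ring.
Qed.

(** The cone generated by a basis of V and its opposite is V, and a form that is
   nonnegative on V vanishes there. *)
Lemma separate_subspace (V : {vspace W}) w : w \notin V ->
  exists x, (forall xi, xi \in V -> pairing x xi = 0) /\ pairing x w != 0.
Proof.
move=> wV; set G := (vbasis V ++ [seq - e | e <- vbasis V]).
have GV e : e \in G -> e \in V.
  rewrite mem_cat => /orP[/vbasis_mem//|/mapP[e' /vbasis_mem e'V ->]].
  by rewrite memvN.
have Dl s x y xi : pairing (x + s *: y) xi = pairing x xi + s * pairing y xi.
  by rewrite pairingDl pairingZl.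
have Dr s x xi xi' : pairing x (xi + s *: xi') = pairing x xi + s * pairing x xi'.
  by rewrite pairingDr pairingZr.
have nd xi : xi != 0 -> exists x : L, pairing x xi != 0.
  move=> xi0; apply: contrapT => nex; move/eqP: xi0; apply; apply: pairing_ext => x.
  rewrite pairing0r; apply/eqP/negP => /negP h; apply: nex; exists x; exact: h.
have [y y0 wE|x [xG xw]] := @farkas R L W (fun x xi => pairing x xi) Dl Dr nd
    (size G) (fun i => G`_i) w.
  move/negP: wV; apply; rewrite wE; apply: rpred_sum => i _.
  by apply: rpredZ; apply/GV/mem_nth.
have xG' e : e \in G -> 0 <= pairing x e.
  by move=> eG; have := xG (Ordinal (etrans (index_mem e G) eG)); rewrite /= nth_index.
exists x; split; last by rewrite lt_eqF.
move=> xi xiV; rewrite (coord_vbasis xiV) pairing_sumr big1// => i _.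
rewrite pairingZr; apply/eqP; rewrite mulf_eq0; apply/orP; right.
have eV : (vbasis V)`_i \in vbasis V by rewrite mem_nth// size_tuple.
rewrite eq_le; apply/andP; split.
  rewrite -oppr_ge0 -pairingNr xG'// mem_cat; apply/orP; right.
  exact: map_f.
by rewrite xG'// mem_cat eV.
Qed.

End Dual.

(** * Facets and vertices of the polytope *)

Section Polytope.
Context {R : realType} {n : nat} {T : torus R n} (D : delzant T).
Local Notation L := (lie T).
Local Notation W := (dual T).
Local Notation F := (facets D).
Implicit Types (f : F) (xi : W).

Definition height (f : F) (xi : W) : R := pairing (normal f) xi + offset f.

Lemma normal_neq0 f : normal f != 0 :> L.
Proof.
apply/negP => /eqP n0; have [_ /(_ 0 0%N)] := normal_primitive f.
by rewrite n0 mulr0n => /(_ (raddf0 _) erefl).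
Qed.

(** The pair (x, a) is the affine function xi |-> pairing x xi + a, extended
   linearly to the product with R, where xi becomes the vector (xi, 1). *)
Definition affpair (c : L * R^o) (v : W * R^o) : R := pairing c.1 v.1 + c.2 * v.2.

Lemma affpairDl s c c' v : affpair (c + s *: c') v = affpair c v + s * affpair c' v.
Proof. by rewrite /affpair/= pairingDl pairingZl -[s *: c'.2]/(s * c'.2); ring. Qed.

Lemma affpairDr s c v v' : affpair c (v + s *: v') = affpair c v + s * affpair c v'.
Proof. by rewrite /affpair/= pairingDr pairingZr -[s *: v'.2]/(s * v'.2); ring. Qed.

Lemma affpair_nd v : v != 0 -> exists c, affpair c v != 0.
Proof.
move=> v0; apply: contrapT => nex; move/eqP: v0; apply.
have c0 c : affpair c v = 0 by apply/eqP/negP => /negP ?; apply: nex; exists c.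
case: v c0 {nex} => xi r c0; congr pair.
  apply: pairing_ext => x; have := c0 (x, 0).
  by rewrite /affpair/= mul0r addr0 pairing0r.
by have := c0 (0, 1); rewrite /affpair/= mul1r pairing0l add0r.
Qed.

(** The direction of the affine hull of the polytope has dimension n, so it is the
   whole dual. *)
Lemma affine_vanish (x : L) (a : R) :
  (forall xi, polytope D xi -> pairing x xi + a = 0) -> x = 0 /\ a = 0.
Proof.
move=> xa; have [x0 Px0 [U dimU affU]] := polytope_dim D.
have Ufull : U = fullv.
  by apply/eqP; rewrite eqEdim subvf /= dim_dual dimU.
have x00 : x = 0.
  apply/eqP/negP => /negP /pairing_neq0[w]; move/negP; apply.
  rewrite -mem_lker_ev; have /subvP -> // : (U <= lker (ev x))%VS.
    apply/affU => xi Pxi; rewrite mem_lker_ev pairingBr.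
    have := xa _ Pxi; have := xa _ Px0 => /(canRL (addrK _)) ->.
    by move=> /(canRL (addrK _)) ->; rewrite subrr.
  by rewrite Ufull memvf.
by split=> //; have := xa _ Px0; rewrite x00 pairing0l add0r.
Qed.

Lemma facet_subset f xi : facet f xi -> polytope D xi.
Proof.
have [[x [a [_ ->]]] _] := (facet_all D (facet f)).2 (ex_intro _ f erefl).
by case.
Qed.

(** The linear form exposing the facet and its normal both vanish on the direction
   of the facet, a hyperplane, so they are proportional. *)
Lemma facetE f : facet f = polytope D `&` [set xi | height f xi = 0].
Proof.
apply/seteqP; split=> xi.
  move=> fxi; split; [exact: facet_subset fxi|exact: facet_eq0].
move=> [Pxi hxi].
have [[x [a [_ fE]]] [d [x0 fx0 [U dimU affU]] nd]] :=
  (facet_all D (facet f)).2 (ex_intro _ f erefl).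
have UE : U = lker (ev (normal f)).
  apply/eqP; rewrite eqEdim; apply/andP; split.
    apply/affU => y fy; rewrite mem_lker_ev pairingBr.
    have := facet_eq0 fy; have := facet_eq0 fx0 => /(canRL (addrK _)) ->.
    by move=> /(canRL (addrK _)) ->; rewrite subrr.
  by rewrite dimU -ltnS -nd dim_lker_ev ?normal_neq0.
have [k xk] : exists k, x = k *: normal f.
  apply: proportional (normal_neq0 f) _ => y.
  move=> /eqP; rewrite -mem_lker_ev -UE => yU; apply/eqP; rewrite -mem_lker_ev.
  have /subvP -> // : (U <= lker (ev x))%VS.
  apply/affU => z; rewrite fE => -[_ /= fz]; rewrite mem_lker_ev pairingBr.
  move: fx0; rewrite fE => -[_ /= fx0].
  by rewrite (canRL (addrK _) fz) (canRL (addrK _) fx0) subrr.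
have fx0' := facet_eq0 fx0.
rewrite fE; split=> //=; move: fx0; rewrite fE => -[_ /= <-]; congr (_ + a).
rewrite xk !pairingZl; congr (k * _).
by rewrite (canRL (addrK _) hxi) (canRL (addrK _) fx0').
Qed.

(** A point outside the polytope is separated from it by a facet: a supporting
   affine function with as many zeros as possible among the generating points
   vanishes on a whole facet. *)
Lemma polytope_halfspaces xi : (forall f, 0 <= height f xi) -> polytope D xi.
Proof.
move=> hge; apply: contrapT => nP.
have [k [s PE]] := polytope_convex D.
have Ps i : polytope D (s i).
  rewrite PE; exists (fun j => (j == i)%:R); split.
  - by move=> j; rewrite ler0n.
  - by rewrite (bigD1 i)//= eqxx big1 ?addr0// => j /negPf ->.
  - by rewrite (bigD1 i)//= eqxx scale1r big1 ?addr0// => j /negPf ->; rewrite scale0r.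
set a := fun i : 'I_k => (s i, 1) : W * R^o.
set b := (xi, 1) : W * R^o.
have span (d : L * R^o) : (forall i, affpair d (a i) = 0) -> d = 0.
  move=> da; have [d1 d2] : d.1 = 0 /\ d.2 = 0.
    apply: affine_vanish => y; rewrite PE => -[c [_ c1 ->]].
    rewrite pairing_sumr -[d.2 : R]mulr1 -c1 mulr_sumr -big_split /= big1// => i _.
    rewrite pairingZr; have := da i; rewrite /affpair/= mulr1 => dai.
    transitivity (c i * (pairing d.1 (s i) + d.2)); first by ring.
    by rewrite dai mulr0.
  by rewrite [d]surjective_pairing d1 d2.
have [|c [ca cb rigid]] := rigid_separation affpairDl affpairDr affpair_nd (b := b) span.
  move=> y y0 bE; apply: nP; rewrite PE; exists y; split=> //.
    have := congr1 snd bE; rewrite /b /a (raddf_sum snd)/= => ->.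
    by apply: eq_bigr => i _; rewrite /= /GRing.scale/= mulr1.
  by have := congr1 fst bE; rewrite /b /a (raddf_sum fst)/= => ->.
have [i0 i0t] : exists i, affpair c (a i) = 0.
  apply: contrapT => nt; apply: nP; have [x0 Px0 _] := polytope_dim D.
  suff -> : xi = x0 by [].
  apply: pairing_ext => x.
  have d0 : (x, - pairing x xi) = 0 :> L * R^o.
    apply: rigid => [i it|]; first by case: nt; exists i.
    by rewrite /affpair/= mulr1 subrr.
  by have -> : x = 0 :> L by [have := congr1 fst d0]; rewrite !pairing0l.
set x := c.1; set r : R := c.2.
have affE y : affpair c (y, 1) = pairing x y + r by rewrite /affpair/= mulr1.
have P0 y : polytope D y -> 0 <= pairing x y + r.
  rewrite PE => -[e [e0 e1 ->]].
  suff -> : pairing x (\sum_i e i *: s i) + r = \sum_i e i * affpair c (a i).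
    by apply: sumr_ge0 => i _; rewrite mulr_ge0.
  rewrite pairing_sumr -[r]mulr1 -e1 mulr_sumr -big_split/=.
  by apply: eq_bigr => i _; rewrite pairingZr affE; ring.
have x0 : x != 0.
  apply/eqP => x0; move: cb i0t; rewrite !affE x0 !pairing0l => rlt r0.
  by rewrite r0 ltxx in rlt.
set Q := polytope D `&` [set y | pairing x y + r = 0].
have Qs i : affpair c (a i) = 0 -> Q (s i) by rewrite affE => h; split.
(* The zero set of the separating function is a facet: by rigidity its linear
   part spans the annihilator of the differences of the tight generators. *)
have Qfacet : is_facet (polytope D) Q.
  split; first by exists x, r.
  have nS := dim_lker_ev x0; exists (\dim (lker (ev x))) => //.
  exists (s i0); first exact: Qs.
  exists (lker (ev x)) => // V; split=> [/subvP sub y [_ /= y0]|QV].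
    apply: sub; rewrite mem_lker_ev pairingBr.
    by have [_ /= si0] := Qs _ i0t; rewrite (canRL (addrK _) y0) (canRL (addrK _) si0) subrr.
  apply/subvP => w; rewrite mem_lker_ev => /eqP xw.
  apply: contrapT => /negP /separate_subspace[z [zV zw]].
  pose d : L * R^o := (z, - pairing z (s i0)).
  have dt i : affpair c (a i) = 0 -> affpair d (a i) = 0.
    by move=> /Qs /QV /zV; rewrite /affpair/= mulr1 pairingBr.
  have : d + (- (affpair d b / affpair c b)) *: c = 0.
    apply: rigid => [i it|]; rewrite affpairDl; first by rewrite (dt i it) it mulr0 addr0.
    by rewrite mulNr divfK ?subrr// lt_eqF.
  move=> /(congr1 fst) /= /eqP; rewrite addr_eq0 => /eqP zE.
  by move: zw; rewrite zE pairingNl pairingZl xw mulr0 oppr0 eqxx.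
(* By rigidity, the affine function attached to this facet is a multiple of the
   separating one. *)
have [f fQ] := (facet_all D Q).1 Qfacet.
pose d : L * R^o := (normal f, offset f).
have dE y : affpair d (y, 1) = height f y by rewrite /affpair/= mulr1.
have dk : d = (affpair d b / affpair c b) *: c.
  apply/eqP; rewrite -subr_eq0 -scaleNr; apply/eqP; apply: rigid => [i it|].
    rewrite affpairDl it mulr0 addr0 dE; apply: facet_eq0; rewrite fQ; exact: Qs.
  by rewrite affpairDl mulNr divfK ?subrr// lt_eqF.
set kap := affpair d b / affpair c b in dk.
have hE y : height f y = kap * (pairing x y + r).
  rewrite -dE dk -affE -[kap *: c]add0r affpairDl.
  by rewrite /affpair/= pairing0l mul0r !add0r.
have [y Py y0] : exists2 y, polytope D y & pairing x y + r != 0.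
  apply: contrapT => ny; have [] := @affine_vanish x r; last by move=> /eqP; rewrite (negPf x0).
  by move=> y Py; apply/eqP/negP => /negP h; apply: ny; exists y.
have k0 : 0 < kap.
  rewrite lt_neqAle; apply/andP; split.
    apply/eqP => k0; have := congr1 fst dk; rewrite -k0 scale0r /= => n0.
    by have := normal_neq0 f; rewrite n0 eqxx.
  have y1 : 0 < pairing x y + r by rewrite lt_def y0 P0.
  by rewrite -(pmulr_lge0 _ y1) -hE; exact: polytope_ge0.
by have := hge f; rewrite hE pmulr_rge0// leNgt -affE cb.
Qed.

End Polytope.

Section Vertices.
Context {R : realType} {n : nat} {T : torus R n} (D : delzant T).
Local Notation L := (lie T).
Local Notation W := (dual T).
Local Notation F := (facets D).
Implicit Types (f : F) (xi : W).

Lemma height_affine f (s : R) xi xi' :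
  height f (xi + s *: (xi' - xi)) = (1 - s) * height f xi + s * height f xi'.
Proof. by rewrite /height pairingDr pairingZr pairingBr; ring. Qed.

Lemma polytopeE xi : polytope D xi <-> forall f, 0 <= height f xi.
Proof.
by split=> [Pxi f|]; [exact: polytope_ge0|exact: polytope_halfspaces].
Qed.

Lemma polytope_segment (s : R) xi xi' : 0 <= s <= 1 ->
  polytope D xi -> polytope D xi' -> polytope D (xi + s *: (xi' - xi)).
Proof.
move=> /andP[s0 s1] /polytopeE P /polytopeE P'; apply/polytopeE => f.
by rewrite height_affine addr_ge0// mulr_ge0// subr_ge0.
Qed.

Lemma polytope_bounded (x : L) : exists M, forall xi, polytope D xi -> pairing x xi <= M.
Proof.
have [k [s PE]] := polytope_convex D.
exists (\sum_i `|pairing x (s i)|) => xi; rewrite PE => -[a [a0 a1 ->]].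
rewrite pairing_sumr ler_sum// => i _; rewrite pairingZr.
apply: le_trans (ler_norm _) _; rewrite normrM ler_piMl// ger0_norm//.
by rewrite -a1 (bigD1 i)//= lerDl sumr_ge0.
Qed.

Lemma height_bounded f : exists M, forall xi, polytope D xi -> height f xi <= M.
Proof.
have [M PM] := polytope_bounded (normal f).
by exists (M + offset f) => xi /PM; rewrite /height lerD2r.
Qed.

(** For each facet, some point of the polytope lies off it; going to midpoints
   preserves the positive heights. *)
Lemma polytope_inner : exists2 xi, polytope D xi & forall f, 0 < height f xi.
Proof.
suff [xi Pxi pos] : exists2 xi, polytope D xi & {in enum F, forall f, 0 < height f xi}.
  by exists xi => // f; apply: pos; rewrite mem_enum.
elim: (enum F) => [|f fs [xi Pxi pos]].
  by have [xi Pxi _] := polytope_dim D; exists xi.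
have [xi' Pxi' pos'] : exists2 xi', polytope D xi' & 0 < height f xi'.
  apply: contrapT => nex; have [] := @affine_vanish _ _ _ D (normal f) (offset f).
    move=> y Py; apply/eqP; rewrite eq_le (polytope_ge0 f Py) andbT leNgt.
    by apply/negP => y0; apply: nex; exists y.
  by move/eqP; rewrite (negPf (normal_neq0 f)).
have half : 0 < (2^-1 : R) < 1 by lra.
exists (xi + 2^-1 *: (xi' - xi)); first by apply: polytope_segment => //; lra.
move=> g; rewrite inE height_affine => /orP[/eqP ->|/pos gpos].
  by have := polytope_ge0 f Pxi; rewrite -/(height f xi); lra.
by have := polytope_ge0 g Pxi'; rewrite -/(height g xi'); lra.
Qed.

(** Among the points of the polytope on all the facets through xi, one on as
   many facets as possible is a vertex: a line through it within all these
   facets would leave the polytope, hence meet one more facet. *)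
Lemma vertex_below xi : polytope D xi ->
  exists2 v, is_vertex (polytope D) v & forall f, facet f xi -> facet f v.
Proof.
have [m] : exists m, (#|[pred f : F | height f xi != 0%R]| < m)%N.
  by eexists; exact: ltnSn.
elim: m xi => // m IH xi lem Pxi.
have [[xi' Pxi' [xi'0 tight]]|rigid] := pselect (exists2 xi', polytope D xi' & xi' != xi /\
    forall f, height f xi = 0 -> height f xi' = 0).
  have [x x0] : exists x, 0 < pairing x (xi' - xi).
    apply: contrapT => nex; move/eqP: xi'0; apply; apply: pairing_ext => x.
    apply/eqP; rewrite -subr_eq0 -pairingBr eq_le.
    apply/andP; split; rewrite leNgt; apply/negP => h; apply: nex.
      by exists x.
    by exists (- x); rewrite pairingNl oppr_gt0.
  have [M PM] := polytope_bounded x.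
  pose b f := height f xi' - height f xi.
  have hE t f : height f (xi + t *: (xi' - xi)) = height f xi + t * b f.
    by rewrite height_affine /b; ring.
  have [j bj] : exists j, b j < 0.
    apply: contrapT => nb; pose t := (`|M| + 1 + `|pairing x xi|) / pairing x (xi' - xi).
    have t0 : 0 <= t by rewrite divr_ge0 ?ltW// !addr_ge0.
    have /PM : polytope D (xi + t *: (xi' - xi)).
      apply/polytopeE => f; rewrite hE addr_ge0//; first exact: polytope_ge0.
      by rewrite mulr_ge0// leNgt; apply/negP => h; apply: nb; exists f.
    rewrite pairingDr pairingZr divfK ?gt_eqF//; have := ler_norm M.
    by have := lerNnormlW (lexx `|pairing x xi|); lra.
  have bpos f : b f < 0 -> 0 < height f xi.
    move=> bf; rewrite lt_def (polytope_ge0 f Pxi) andbT; apply/eqP => h.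
    by move: bf; rewrite /b h (tight _ h) subrr ltxx.
  have [t t0 [tge [i bi it]]] := @first_hit _ _ (fun f => height f xi) b j
     (fun f => polytope_ge0 f Pxi)
     bpos bj.
  have [||v vv vf] := IH (xi + t *: (xi' - xi)).
  - rewrite ltnS in lem; apply: leq_trans lem; apply: proper_card; apply/properP; split.
      apply/fintype.subsetP => f; rewrite !inE; apply: contraNN => /eqP h.
      by rewrite hE /b h (tight _ h) subrr mulr0 addr0.
    exists i; rewrite !inE ?hE ?it ?eqxx//.
    by apply/eqP => h; move: bi; rewrite /b h (tight _ h) subrr ltxx.
  - by apply/polytopeE => f; rewrite hE.
  exists v => // f fxi; apply: vf; move: fxi; rewrite !facetE => -[_ /= h]; split=> /=.
    by apply/polytopeE => g; rewrite hE.
  by rewrite hE /b h (tight _ h) subrr mulr0 addr0.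
(* As xi is the only point on all the facets through it, the sum of their heights
   vanishes at xi only. *)
exists xi => //.
exists (\sum_(f : F | height f xi == 0) normal f), (\sum_(f : F | height f xi == 0) offset f).
have sE y : pairing (\sum_(f : F | height f xi == 0) normal f) y +
    \sum_(f : F | height f xi == 0) offset f =
  \sum_(f : F | height f xi == 0) height f y by rewrite pairing_suml -big_split.
split=> [y Py|]; first by rewrite sE sumr_ge0// => f _; exact: polytope_ge0.
apply/seteqP; split=> y /=.
  by move=> ->; split=> //; rewrite sE big1// => f /eqP.
move=> [Py]; rewrite sE => /eqP; rewrite psumr_eq0; last by move=> f _; exact: polytope_ge0.
move=> /allP all0; apply/eqP/negP => /negP yxi; apply: rigid; exists y => //; split=> // f /eqP fxi.
by have := all0 f (mem_index_enum f); rewrite fxi => /eqP.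
Qed.

End Vertices.

(** * The basis of normals at a vertex *)

Section VertexBasis.
Context {R : realType} {n : nat} {T : torus R n} (D : delzant T).
Local Notation L := (lie T).
Local Notation W := (dual T).
Local Notation F := (facets D).
Implicit Types (xi v : W).

Definition normals_at v : #|facets_at D v|.-tuple L :=
  [tuple normal (val (enum_val i)) | i < #|facets_at D v|].

Definition ncoord v (f : facets_at D v) : {linear L -> R^o} := coord (normals_at v) (enum_rank f).

Section AtVertex.
Context {v : W} (hv : is_vertex (polytope D) v).
Local Notation A := (facets_at D v).

Lemma vertex_integral x : lattice x ->
  exists c : A -> int, x = \sum_f (c f)%:~R *: normal (val f).
Proof.
move=> lx; have [c [xE _]] := normal_basis hv lx; exists c; rewrite xE.
by apply: eq_bigr => f _; rewrite scaler_int.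
Qed.

Lemma lattice_integral_basis : exists b : n.-tuple L, [/\ basis_of {:L} b,
  forall x, lattice x <-> exists c : 'I_n -> int, x = \sum_(i < n) tnth b i *~ c i
  & exists E : 'I_n -> A -> int,
      forall i, tnth b i = \sum_g (E i g)%:~R *: normal (val g)].
Proof.
have [b [bbas latb]] := texp_ker T; exists b; split=> //.
suff /choice[E EE] : forall i, exists c : A -> int,
    tnth b i = \sum_g (c g)%:~R *: normal (val g) by exists E.
move=> i; apply: vertex_integral; apply/latb.
exists (fun j => (j == i)%:R); rewrite (bigD1 i)//= eqxx mulr1z big1 ?addr0//.
by move=> j /negPf ->; rewrite mulr0z.
Qed.

(** Integral independence gives real independence: with the matrices C and E
   expressing the normals and an integral basis of the lattice by one another,
   CE = 1 by uniqueness of integral coefficients, so tC = 0 implies t = 0 for any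
   real row vector t. *)
Lemma vertex_indep (t : A -> R) :
  \sum_f t f *: normal (val f) = 0 -> forall f, t f = 0.
Proof.
move=> t0 f.
have [b [/andP[_ bfree] latb [E EE]]] := lattice_integral_basis.
have /choice[C CE] : forall g : A, exists c : 'I_n -> int, normal (val g) = \sum_i tnth b i *~ c i.
  by move=> g; apply/latb; have [] := normal_primitive (val g).
have CEf g : \sum_i C g i * E i f = (g == f)%:R.
  have lg : lattice (normal (val g)) by have [] := normal_primitive (val g).
  have [c [_ cu]] := normal_basis hv lg.
  have <- : c f = (g == f)%:R.
    have -> : c = [ffun h => (h == g)%:R].
      apply: cu; rewrite (bigD1 g)//= ffunE eqxx mulr1z big1 ?addr0// => h /negPf hg.
      by rewrite ffunE hg mulr0z.
    by rewrite ffunE eq_sym.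
  have -> : c = [ffun h => \sum_i C g i * E i h].
    apply: cu; rewrite {1}CE.
    under eq_bigr do rewrite EE mulrz_suml.
    rewrite exchange_big/=; apply: eq_bigr => h _; rewrite ffunE mulrz_sumr.
    by apply: eq_bigr => i _; rewrite scaler_int -mulrzA mulrC.
  by rewrite ffunE.
have Ct i : \sum_g t g * (C g i)%:~R = 0.
  have : \sum_(i < n) (\sum_g t g * (C g i)%:~R) *: b`_i = 0.
    rewrite -[RHS]t0.
    under [RHS]eq_bigr do rewrite CE scaler_sumr.
    rewrite exchange_big/=; apply: eq_bigr => j _; rewrite scaler_suml.
    by apply: eq_bigr => g _; rewrite -scalerA scaler_int (tnth_nth 0).
  by move/(freeP bfree).
transitivity (\sum_g t g * ((g == f)%:R : int)%:~R).
  rewrite (bigD1 f)//= eqxx mulr1 big1 ?addr0// => g /negPf ->.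
  by rewrite mulr0.
under eq_bigr do rewrite -CEf rmorph_sum mulr_sumr.
rewrite exchange_big big1//= => i _.
under eq_bigr do rewrite rmorphM mulrA.
by rewrite -mulr_suml Ct mul0r.
Qed.

Lemma vertex_span x : exists t : A -> R, x = \sum_f t f *: normal (val f).
Proof.
have [b [bbas _ [E EE]]] := lattice_integral_basis.
exists (fun g => \sum_i coord b i x * (E i g)%:~R).
rewrite {1}(coord_basis bbas (memvf x)).
under eq_bigr do rewrite -tnth_nth EE scaler_sumr.
rewrite exchange_big/=; apply: eq_bigr => g _; rewrite scaler_suml.
by apply: eq_bigr => i _; rewrite scalerA.
Qed.

Lemma normals_at_basis : basis_of {:L} (normals_at v).
Proof.
have bE (i : 'I_#|A|) : (normals_at v)`_i = normal (val (enum_val i)).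
  by rewrite -tnth_nth tnth_mktuple.
apply/andP; split.
  rewrite eqEsubv subvf; apply/subvP => x _.
  have [t ->] := vertex_span x; apply: rpred_sum => f _; apply: rpredZ.
  apply: memv_span; apply/tnthP; exists (enum_rank f).
  by rewrite tnth_mktuple enum_rankK.
apply/freeP => k k0 i; rewrite -(enum_valK i).
apply: (@vertex_indep (fun f => k (enum_rank f))); rewrite -[RHS]k0.
rewrite (reindex (@enum_val _ A)); last exact/onW_bij/enum_val_bij.
by apply: eq_bigr => j _; rewrite enum_valK bE.
Qed.

Lemma card_facets_at : #|A| = n.
Proof.
have /andP[/eqP sp fr] := normals_at_basis.
by have := fr; rewrite /free size_tuple sp (lie_dim T) => /eqP.
Qed.

Lemma ncoordE x : x = \sum_(f : A) ncoord f x *: normal (val f).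
Proof.
rewrite {1}(coord_basis normals_at_basis (memvf x)).
rewrite [RHS](reindex (@enum_val _ A)); last exact/onW_bij/enum_val_bij.
by apply: eq_bigr => i _; rewrite /ncoord enum_valK -tnth_nth tnth_mktuple.
Qed.

Lemma ncoord_unique (t : A -> R) (f : A) : ncoord f (\sum_(g : A) t g *: normal (val g)) = t f.
Proof.
apply/eqP; rewrite -subr_eq0; apply/eqP; move: f.
apply: (@vertex_indep (fun f : A => ncoord f (\sum_(g : A) t g *: normal (val g)) - t f)).
under eq_bigr do rewrite scalerBl.
by rewrite sumrB -ncoordE subrr.
Qed.

Lemma ncoord_normal (f g : A) : ncoord f (normal (val g)) = (g == f)%:R.
Proof.
transitivity (ncoord f (\sum_(h : A) (g == h)%:R *: normal (val h))); last by rewrite ncoord_unique.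
congr (ncoord f _); rewrite (bigD1 g)//= eqxx scale1r big1 ?addr0// => h.
by rewrite eq_sym => /negPf ->; rewrite scale0r.
Qed.

Lemma ncoord_lattice (f : A) x : lattice x -> exists m : int, ncoord f x = m%:~R.
Proof.
by move=> /vertex_integral[c ->]; exists (c f); rewrite ncoord_unique.
Qed.

Lemma vertex_dual (y : A -> R) : exists xi, forall f, pairing (normal (val f)) xi = y f.
Proof.
exists (\sum_(g : A) y g *: linfun (ncoord g)) => f.
rewrite pairing_sumr (bigD1 f)//= big1 ?addr0 => [|g gf];
  rewrite pairingZr /pairing lfunE ncoord_normal.
  by rewrite eqxx mulr1.
by rewrite eq_sym (negPf gf) mulr0.
Qed.

Lemma vertex_ext xi xi' :
  (forall f : A, pairing (normal (val f)) xi = pairing (normal (val f)) xi') -> xi = xi'.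
Proof.
move=> h; apply: pairing_ext => x; rewrite (ncoordE x) !pairing_suml.
by apply: eq_bigr => f _; rewrite !pairingZl h.
Qed.

Lemma vertex_polytope : polytope D v.
Proof.
case: hv => x [a [_ e]]; have : [set v] v by [].
by rewrite e => -[].
Qed.

Lemma height_at (f : A) : height (val f) v = 0.
Proof. by apply: facet_eq0; have := valP f; rewrite in_setE. Qed.

Lemma height_not_at (f : F) : v \notin facet f -> 0 < height f v.
Proof.
move=> nf; rewrite lt_def (polytope_ge0 f vertex_polytope) andbT.
apply/negP => /eqP h; move/negP: nf; apply; rewrite in_setE facetE; split=> //.
exact: vertex_polytope.
Qed.

(** In the chart at v, where the heights of the facets through v are half the
   squares of the absolute values of the coordinates, all the heights are thus
   quadratic. *)
Lemma height_vertex (g : F) xi :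
  height g xi = \sum_(f : A) ncoord f (normal g) * height (val f) xi + height g v.
Proof.
rewrite /height {1 3}(ncoordE (normal g)) !pairing_suml.
rewrite addrA; congr (_ + _); rewrite -big_split/=; apply: eq_bigr => f _.
rewrite !pairingZl -mulrDr; congr (_ * _).
by have /eqP := height_at f; rewrite /height addr_eq0 => /eqP ->; rewrite addrK.
Qed.

End AtVertex.
End VertexBasis.

(** * Polar coordinates *)

Section Polar.
Context {R : realType}.
Implicit Types (t : R) (w : R[i]).

Lemma mulcE (a b c d : R) :
  Complex a b * Complex c d = Complex (a * c - b * d) (a * d + b * c) :> R[i].
Proof. by []. Qed.

Definition cis t : R[i] := Complex (cos (2 * pi * t)) (sin (2 * pi * t)).

Lemma cisD s t : cis (s + t) = cis s * cis t.
Proof.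
rewrite /cis mulrDr cosD sinD; congr Complex.
by rewrite addrC [sin _ * cos _]mulrC addrC.
Qed.

Lemma cis0 : cis 0 = 1.
Proof. by rewrite /cis mulr0 cos0 sin0. Qed.

Lemma cis1 : cis 1 = 1.
Proof. by rewrite /cis mulr1 mulr_natl cos2pi mulr2n sinD sinpi mul0r mulr0 addr0. Qed.

Lemma cis_neq0 t : cis t != 0.
Proof.
apply/eqP => c0; have := cisD t (- t); rewrite subrr cis0 c0 mul0r => /eqP.
by rewrite oner_eq0.
Qed.

Lemma cisN t : cis (- t) = (cis t)^-1.
Proof.
by apply: (mulfI (cis_neq0 t)); rewrite -cisD subrr cis0 divff// cis_neq0.
Qed.

Lemma cisMz t (k : int) : cis (t * k%:~R) = cis t ^ k.
Proof.
have cisn (m : nat) : cis (t * m%:R) = cis t ^+ m.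
  elim: m => [|m IH]; first by rewrite mulr0 cis0.
  by rewrite -natr1 mulrDr mulr1 cisD IH exprSr.
case: k => m; first exact: cisn.
by rewrite [in LHS]NegzE mulrNz mulrN cisN; congr _^-1; exact: cisn.
Qed.

Lemma cis_int (k : int) : cis k%:~R = 1.
Proof. by rewrite -[k%:~R]mul1r cisMz cis1 exp1rz. Qed.

Lemma cis_sum (I : Type) (s : seq I) (P : pred I) (f : I -> R) :
  cis (\sum_(i <- s | P i) f i) = \prod_(i <- s | P i) cis (f i).
Proof. by apply: (big_morph cis cisD cis0). Qed.

Lemma cis_surj (x y : R) : x ^+ 2 + y ^+ 2 = 1 -> exists t, cis t = Complex x y.
Proof.
move=> xy1; have x1 : -1 <= x <= 1.
  rewrite -ler_norml -(@ler_pXn2r _ 2)// ?nnegrE// expr1n real_normK ?num_real//.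
  by rewrite -xy1 lerDl sqr_ge0.
have pi0 : 2 * pi != 0 :> R by rewrite mulf_neq0 ?pnatr_eq0// gt_eqF// pi_gt0.
have xacos : cos (acos x) = x by rewrite acosK// in_itv.
have sacos : sin (acos x) = `|y|.
  by rewrite sin_acos// -xy1 addrAC subrr add0r sqrtr_sqr.
have [y0|y0] := leP 0 y.
  exists (acos x / (2 * pi)); rewrite /cis [_ * (_ / _)]mulrC divfK// xacos sacos.
  by rewrite ger0_norm.
exists (- acos x / (2 * pi)); rewrite /cis [_ * (_ / _)]mulrC divfK// cosN sinN.
by rewrite xacos sacos ltr0_norm// opprK.
Qed.

End Polar.

Section Coordinates.
Context {R : realType} {B : finType}.
Implicit Types (z : cspace R B) (b : B).

Definition zc z b : R[i] := Complex (re z b) (im z b).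

Lemma zcP z z' : (forall b, zc z b = zc z' b) -> z = z'.
Proof. by move=> e; apply: cspaceP => b; have [] := e b. Qed.

Lemma zc_cvec (x y : B -> R) b : zc (cvec x y) b = Complex (x b) (y b).
Proof. by rewrite /zc re_cvec im_cvec. Qed.

Lemma zc_rot t z b : zc (rot t z) b = cis (t b) * zc z b.
Proof. by rewrite /zc re_cvec im_cvec; congr Complex; rewrite addrC. Qed.

Lemma moment_ge0 z b : 0 <= moment z b.
Proof. by rewrite divr_ge0 ?addr_ge0 ?sqr_ge0. Qed.

Lemma moment_eq0 z b : (moment z b == 0) = (zc z b == 0).
Proof.
rewrite mulf_eq0 orbC invr_eq0 pnatr_eq0/= paddr_eq0 ?sqr_ge0// !sqrf_eq0.
by rewrite eq_complex.
Qed.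

Definition sqnorm (w : R[i]) : R := complex.Re w ^+ 2 + complex.Im w ^+ 2.

Lemma sqnormM w w' : sqnorm (w * w') = sqnorm w * sqnorm w'.
Proof. by case: w w' => [a b] [c d]; rewrite /sqnorm/=; ring. Qed.

Lemma sqnorm_cis t : sqnorm (cis t) = 1.
Proof. by rewrite /sqnorm cos2Dsin2. Qed.

Lemma momentE z b : moment z b = sqnorm (zc z b) / 2.
Proof. by []. Qed.

Lemma moment_rot t z b : moment (rot t z) b = moment z b.
Proof. by rewrite !momentE zc_rot sqnormM sqnorm_cis mul1r. Qed.

(** The phase of a coordinate, meaningful where the coordinate does not vanish. *)
Definition phase z b : R[i] := Complex (re z b / Num.sqrt (2 * moment z b))
                                       (im z b / Num.sqrt (2 * moment z b)).

Lemma zc_phase z b : zc z b = Complex (Num.sqrt (2 * moment z b)) 0 * phase z b.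
Proof.
have [m0|m0] := eqVneq (moment z b) 0.
  have /eqP -> : zc z b == 0 by rewrite -moment_eq0 m0.
  by rewrite m0 mulr0 sqrtr0 mul0r.
have s0 : Num.sqrt (2 * moment z b) != 0.
  by rewrite sqrtr_eq0 -ltNge mulr_gt0// lt_def m0 moment_ge0.
have sK x : Num.sqrt (2 * moment z b) * (x / Num.sqrt (2 * moment z b)) = x.
  by rewrite mulrC divfK.
by rewrite /phase /zc mulcE !mul0r subr0 addr0 !sK.
Qed.

Lemma phase_cis z b : moment z b != 0 -> exists t, phase z b = cis t.
Proof.
move=> m0; have [|t tE] := @cis_surj R (re z b / Num.sqrt (2 * moment z b))
   (im z b / Num.sqrt (2 * moment z b)); last by exists t.
rewrite !expr_div_n (sqr_sqrtr (mulr_ge0 (ler0n _ 2) (moment_ge0 z b))) -mulrDl.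
rewrite (_ : _ + _ = 2 * moment z b); last by rewrite /moment mulrC divfK ?pnatr_eq0.
by rewrite divff// mulf_neq0// pnatr_eq0.
Qed.

Lemma phase_rot t z b : phase (rot t z) b = cis (t b) * phase z b.
Proof.
rewrite /phase moment_rot re_cvec im_cvec /cis mulcE; congr Complex.
  by rewrite mulrBl !mulrA.
by rewrite mulrDl !mulrA addrC.
Qed.

End Coordinates.

(** * The level set and its quotient *)

Section LevelSet.
Local Open Scope quotient_scope.
Context {R : realType} {n : nat} {T : torus R n} (D : delzant T).
Local Notation L := (lie T).
Local Notation W := (dual T).
Local Notation F := (facets D).
Implicit Types (xi v : W) (z : cspace R F).

Lemma exists_vertex : exists v, is_vertex (polytope D) v.
Proof. by have [xi /vertex_below[v hv _] _] := polytope_dim D; exists v. Qed.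

Lemma sum_facets_at (V : nmodType) v (P : F -> V) :
  \sum_g P g = \sum_(f : facets_at D v) P (val f) + \sum_(g | v \notin facet g) P g.
Proof. by rewrite (bigID (fun g : F => v \in facet g))/= big_sub. Qed.

Lemma ncoord_projF v (hv : is_vertex (polytope D) v) (t : {ffun F -> R}) (f : facets_at D v) :
  ncoord f (projF D t) = t (val f) + \sum_(g | v \notin facet g) t g * ncoord f (normal g).
Proof.
rewrite /projF linear_sum/= (sum_facets_at v); congr (_ + _).
  rewrite (bigD1 f)//= big1 ?addr0 => [|g gf]; rewrite linearZ/= (ncoord_normal hv).
    by rewrite eqxx mulr1.
  by rewrite (negPf gf) mulr0.
by apply: eq_bigr => g _; rewrite linearZ.
Qed.

(** A linear form on R^F vanishing on the kernel of projF factors through projF.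
   Here xi is determined on the basis of normals at a vertex, and the condition
   for another normal g is tested on the relation between g and this basis. *)
Lemma levelZP z : levelZ D z <-> exists xi, forall f, moment z f = height f xi.
Proof.
split=> [Zz|[xi mz] t t0]; last first.
  under eq_bigr do rewrite mz mulrDl.
  rewrite big_split/= -[RHS]add0r; congr (_ + _).
  transitivity (pairing (projF D t) xi); last by rewrite t0 pairing0l.
  by rewrite pairing_suml; apply: eq_bigr => f _; rewrite pairingZl mulrC.
have [v hv] := exists_vertex.
have [xi xiE] := vertex_dual hv (fun f => moment z (val f) - offset (val f)).
exists xi => g.
pose c h : R := if insub h is Some f then ncoord (f : facets_at D v) (normal g) else 0.
pose t : {ffun F -> R} := [ffun h => (h == g)%:R - c h].
have ct (V : lmodType R) (P : F -> V) :
    \sum_h t h *: P h = P g - \sum_(f : facets_at D v) ncoord f (normal g) *: P (val f).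
  under eq_bigr do rewrite ffunE scalerBl.
  rewrite sumrB; congr (_ - _).
    rewrite (bigD1 g)//= eqxx scale1r big1 ?addr0// => h /negPf ->.
    by rewrite scale0r.
  rewrite (sum_facets_at v) [X in _ + X]big1 ?addr0 => [|h hf].
    by apply: eq_bigr => f _; rewrite /c valK.
  by rewrite /c insubN// scale0r.
have tn : lie_n D t by rewrite /lie_n /projF /= ct -ncoordE// subrr.
have sc (P : F -> R) : \sum_h P h * t h = \sum_h t h *: (P h : R^o).
  by apply: eq_bigr => h _; rewrite mulrC.
have := Zz t tn; rewrite !sc !ct => /eqP.
rewrite subr_eq -addrA => /eqP ->; rewrite /height addrC; congr (_ + _).
rewrite [in RHS](ncoordE hv (normal g)) pairing_suml addrC -sumrB.
by apply: eq_bigr => f _; rewrite pairingZl xiE -scalerBr.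
Qed.

Lemma levelZ_polytope z xi : (forall f, moment z f = height f xi) -> polytope D xi.
Proof. by move=> mz; apply/polytopeE => f; rewrite -mz moment_ge0. Qed.

Lemma levelZ_rot t z : levelZ D z -> levelZ D (rot t z).
Proof. by move=> /levelZP[xi mz]; apply/levelZP; exists xi => f; rewrite moment_rot. Qed.

Lemma height_ext xi xi' : (forall f : F, height f xi = height f xi') -> xi = xi'.
Proof.
have [v hv] := exists_vertex => h; apply: (vertex_ext hv) => f.
by have /addIr := h (val f).
Qed.

Definition inZ z (Zz : levelZ D z) : levelZ D := exist _ z (mem_set Zz).

Lemma insubd_inZ z (Zz : levelZ D z) : insubd (base_point D) z = inZ Zz.
Proof. by apply: val_inj; rewrite /= val_insubd mem_set. Qed.

Lemma projM_inZ z (Zz : levelZ D z) : projM D z = \pi_(delzant_space D) (inZ Zz).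
Proof. by rewrite /projM insubd_inZ. Qed.

Lemma projM_eq z z' : levelZ D z -> levelZ D z' ->
  projM D z = projM D z' <-> exists2 t, groupN D t & z' = rot t z.
Proof.
move=> Zz Zz'; rewrite (projM_inZ Zz) (projM_inZ Zz').
split=> [/eqmodP/asboolP//|h].
exact/eqmodP/asboolP.
Qed.

Lemma projM_surj (m : delzant_space D) : exists2 z, levelZ D z & projM D z = m.
Proof.
exists (val (repr m)); first exact: set_valP.
rewrite (projM_inZ (set_valP (repr m))) -[RHS]reprK; congr (\pi _).
exact: val_inj.
Qed.

Lemma moment_T_projM z xi : levelZ D z -> (forall f, moment z f = height f xi) ->
  moment_T D (projM D z) = xi.
Proof.
move=> Zz mz; rewrite /moment_T.
case: xgetP => [xi' _ /= h|]; last first.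
  move=> /(_ xi); case => z' Zz' /(projM_eq Zz' Zz)[s _ zE] t.
  rewrite /projF linear_sum; apply: eq_bigr => f _; rewrite linearZ/= mulrC.
  by move: (mz f); rewrite zE moment_rot => ->; rewrite /height addrK.
apply: height_ext => f; have := h z Zz erefl [ffun g => (g == f)%:R].
rewrite /projF (bigD1 f)//= big1 ?addr0 => [|g /negPf gf]; last by rewrite ffunE gf scale0r.
rewrite (bigD1 f)//= big1 ?addr0 => [|g /negPf gf]; last by rewrite ffunE gf mulr0.
rewrite ffunE eqxx scale1r mulr1 => e.
by rewrite -mz /height /pairing e subrK.
Qed.

Lemma open_delzantP (A : set (delzant_space D)) :
  open A <-> exists2 U, open U & levelZ D `&` projM D @^-1` A = levelZ D `&` U.
Proof.
split=> [ | [U oU AE] ].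
  rewrite /open/= /quotient_open => -[U oU UE]; exists U => //.
  apply/seteqP; split=> z [Zz Az]; split=> //.
    have : (\pi_(delzant_space D) @^-1` A) (inZ Zz) by rewrite /= -projM_inZ.
    by rewrite -UE.
  have : (set_val @^-1` U : set (levelZ D)) (inZ Zz) by [].
  by rewrite [X in X _]UE /= -projM_inZ.
rewrite /open/= /quotient_open; exists U => //.
apply/seteqP; split=> -[z zZ] /=; have Zz := set_mem zZ.
  have -> : exist _ z zZ = inZ Zz :> levelZ D by exact: val_inj.
  move=> Uz; have : (levelZ D `&` U) z by split.
  by rewrite -AE -projM_inZ => -[].
have -> : exist _ z zZ = inZ Zz :> levelZ D by exact: val_inj.
rewrite -projM_inZ => Az; have : (levelZ D `&` projM D @^-1` A) z by split.
by rewrite AE => -[].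
Qed.

End LevelSet.

(** * The domain of the coordinates near a vertex *)

Lemma open_pos_family (R : realType) (X : topologicalType) (I : finType)
    (P : pred I) (h : I -> X -> R) : (forall i, continuous (h i)) ->
  open [set x | forall i, P i -> 0 < h i x].
Proof.
move=> ch; rewrite openE => x hx; rewrite /interior/=.
have near_pos i : nbhs x [set y | P i -> 0 < h i y].
  have [Pi|_] := boolP (P i); last by apply: filterS filterT => y.
  have : nbhs (h i x) [set r | 0 < r].
    by apply: open_nbhs_nbhs; split; [exact: open_gt|exact: hx].
  move=> /(ch i x) pos.
  by apply: (@filterS _ _ _ [set y | 0 < h i y]) pos => y /= hy _.
have := @filter_forall _ I (fun i y => P i -> 0 < h i y) (nbhs x) _ near_pos.
exact.
Qed.


Section VertexChart.
Context {R : realType} {n : nat} {T : torus R n} (D : delzant T).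
Local Notation W := (dual T).
Local Notation F := (facets D).
Implicit Types (xi : W) (z : cspace R F).
Context {v : W} (hv : is_vertex (polytope D) v).
Local Notation A := (facets_at D v).
Implicit Types (f : A) (g : F) (u : cspace R A).

Lemma rhoE z f : zc (rho D v z) f = zc z (val f).
Proof. by rewrite zc_cvec. Qed.

Lemma moment_rho z f : moment (rho D v z) f = moment z (val f).
Proof. by rewrite !momentE rhoE. Qed.

Lemma moment_at_spec u f : height (val f) (moment_at D v u) = moment u f.
Proof.
have [xi xiE] := vertex_dual hv (fun f => moment u f - offset (val f)).
rewrite /moment_at; case: xgetP => [xi' _ /= e|/(_ xi)]; last first.
  by case=> f'; rewrite xiE.
by rewrite /height -e subrK.
Qed.

Lemma moment_at_unique u xi : (forall f, height (val f) xi = moment u f) ->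
  moment_at D v u = xi.
Proof.
move=> h; apply: (vertex_ext hv) => f; apply: (addIr (offset (val f))).
by have := moment_at_spec u f; rewrite -h.
Qed.

Lemma height_moment_at u g :
  height g (moment_at D v u) = \sum_f ncoord f (normal g) * moment u f + height g v.
Proof. by rewrite (height_vertex hv); under eq_bigr do rewrite moment_at_spec. Qed.

Lemma moment_cvec (B : finType) (x y : B -> R) b :
  moment (cvec x y) b = (x b ^+ 2 + y b ^+ 2) / 2.
Proof. by rewrite /moment re_cvec im_cvec. Qed.

Lemma zc_section_in u f : zc (section_at D v u) (val f) = zc u f.
Proof. by rewrite zc_cvec valK. Qed.

Lemma zc_section_out u g : v \notin facet g ->
  zc (section_at D v u) g = Complex (rad D g (moment_at D v u)) 0.
Proof. by move=> vg; rewrite zc_cvec insubN. Qed.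

Lemma rho_section u : rho D v (section_at D v u) = u.
Proof. by apply: zcP => f; rewrite rhoE zc_section_in. Qed.

Lemma moment_section u g : (forall g, v \notin facet g -> 0 <= height g (moment_at D v u)) ->
  moment (section_at D v u) g = height g (moment_at D v u).
Proof.
move=> h; have [vg|vg] := boolP (v \in facet g).
  have -> : g = val (exist _ g vg : A) by [].
  by rewrite moment_at_spec !momentE zc_section_in.
rewrite momentE zc_section_out// /sqnorm/= expr0n addr0 sqr_sqrtr ?mulr_ge0 ?h//.
by rewrite mulrC mulKf ?pnatr_eq0.
Qed.

Lemma levelZ_section u : (forall g, v \notin facet g -> 0 <= height g (moment_at D v u)) ->
  levelZ D (section_at D v u).
Proof. by move=> h; apply/levelZP; exists (moment_at D v u) => g; exact: moment_section. Qed.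

Lemma moment_at_rho z xi : (forall g, moment z g = height g xi) ->
  moment_at D v (rho D v z) = xi.
Proof. by move=> mz; apply: moment_at_unique => f; rewrite moment_rho mz. Qed.

Lemma Ck_moment k (E : normedModType R) (U : set E) (B : finType) (h : E -> cspace R B) b :
  open U -> Ck k U h -> Ck k U (fun x => moment (h x) b : R^o).
Proof.
move=> oU Ch; have Cre := Ck_coord (enum_rank b) ord0 oU Ch.
have Cim := Ck_coord (enum_rank b) ord_max oU Ch.
rewrite /moment /re /im.
under eq_fun do rewrite !expr2.
by do !apply: Ck_mul => //; [|exact: Ck_cst]; apply: Ck_add => //; exact: Ck_mul.
Qed.

Lemma Ck_id k (B : finType) (U : set (cspace R B)) : Ck k U (fun u : cspace R B => u).
Proof. by apply: (@Ck_linear _ _ _ _ _ idfun) => x. Qed.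

Lemma continuous_moment (B : finType) b : continuous (fun u : cspace R B => moment u b).
Proof. by move=> u; exact: (Ck_moment (k := 0) b openT (@Ck_id 0 B setT)). Qed.

Lemma Ck_height_moment_at k U g : open U -> Ck k U (fun u => height g (moment_at D v u) : R^o).
Proof.
move=> oU; under eq_fun do rewrite height_moment_at.
apply: Ck_add => //; last exact: Ck_cst.
apply: Ck_sum => // f _; apply: Ck_mul => //; first exact: Ck_cst.
by apply: Ck_moment => //; exact: Ck_id.
Qed.

Lemma continuous_height_moment_at g : continuous (fun u => height g (moment_at D v u)).
Proof. by move=> u; apply: (@Ck_height_moment_at 0 setT g openT u). Qed.

Definition chart_dom : set (cspace R A) :=
  [set u | forall g, v \notin facet g -> 0 < height g (moment_at D v u)].

Lemma open_chart_dom : open chart_dom.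
Proof. exact: open_pos_family continuous_height_moment_at. Qed.

(** At an interior point of the image of the level set, the heights of the facets
   away from v are positive: along the ray through that point they vary as
   a s^2 + b with b > 0, so they would be negative just beyond a zero. *)
Lemma domUE : domU D v = chart_dom.
Proof.
apply/seteqP; split=> u.
  rewrite /domU /interior => /nbhs_ballP[e /= e0 sub] g vg.
  set a := \sum_f ncoord f (normal g) * moment u f.
  have hE s : height g (moment_at D v (s *: u)) = s ^+ 2 * a + height g v.
    rewrite height_moment_at /a mulr_sumr; congr (_ + _); apply: eq_bigr => f _.
    by rewrite /moment /re /im !mxE; ring.
  have b0 := height_not_at hv vg.
  have h1 := hE 1; rewrite scale1r expr1n mul1r in h1.
  rewrite ltNge; apply/negP => hle.
  have [s s1 su] : exists2 s, 1 < s & ball u e (s *: u).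
    have d0 : 0 < e / (2 * (`|u| + 1)) by rewrite divr_gt0// mulr_gt0// ltr_wpDl.
    exists (1 + e / (2 * (`|u| + 1))); first by rewrite ltrDl.
    rewrite -ball_normE /= scalerDl scale1r opprD addNKr normrN normrZ gtr0_norm//.
    have u1 : 0 < `|u| + 1 by rewrite ltr_wpDl.
    rewrite -[ltRHS](divfK (lt0r_neq0 (mulr_gt0 (@ltr0n R 2) u1))).
    by rewrite ltr_pM2l//; have := normr_ge0 u; lra.
  have [z Zz zE] := sub _ su.
  have /levelZP[xi mz] := Zz.
  have : 0 <= height g (moment_at D v (s *: u)) by rewrite -zE (moment_at_rho mz) -mz moment_ge0.
  rewrite hE => h2; have s2 : 1 < s ^+ 2 by rewrite expr_gt1// (le_trans ler01)// ltW.
  have a0 : a < 0 by lra.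
  nra.
move=> hu; rewrite /domU /interior; apply: (@filterS _ _ _ chart_dom).
  move=> u' hu'; exists (section_at D v u'); last exact: rho_section.
  by apply: levelZ_section => g /hu' /ltW.
by apply: open_nbhs_nbhs; split=> //; exact: open_chart_dom.
Qed.

Lemma levelZ_atE : levelZ_at D v =
  levelZ D `&` [set z | forall g, v \notin facet g -> 0 < moment z g].
Proof.
rewrite /levelZ_at domUE; apply/seteqP; split=> z.
  move=> [hz Zz]; split=> // g vg; have /levelZP[xi mz] := Zz.
  by have := hz g vg; rewrite (moment_at_rho mz) -mz.
move=> [Zz hz]; split=> // g vg; have /levelZP[xi mz] := Zz.
by rewrite (moment_at_rho mz) -mz hz.
Qed.

End VertexChart.

(** * The inverse of the coordinates near a vertex *)

Section ComplexSmooth.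
Context {R : realType} {E : normedModType R}.

Definition cCk k (U : set E) (w : E -> R[i]) :=
  Ck k U (fun x => complex.Re (w x) : R^o) /\ Ck k U (fun x => complex.Im (w x) : R^o).

Lemma cCk_mul k U (w w' : E -> R[i]) : open U ->
  cCk k U w -> cCk k U w' -> cCk k U (fun x => w x * w' x).
Proof.
move=> oU [rw iw] [rw' iw']; split.
  have -> : (fun x => complex.Re (w x * w' x) : R^o) =
    fun x => complex.Re (w x) * complex.Re (w' x) + - (complex.Im (w x) * complex.Im (w' x)).
    by apply/funext => x; case: (w x) (w' x) => [a b] [c d].
  by apply: Ck_add; [|apply: Ck_mul|apply: Ck_opp => //; apply: Ck_mul].
have -> : (fun x => complex.Im (w x * w' x) : R^o) =
    fun x => complex.Re (w x) * complex.Im (w' x) + complex.Im (w x) * complex.Re (w' x).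
  by apply/funext => x; case: (w x) (w' x) => [a b] [c d].
by apply: Ck_add => //; apply: Ck_mul.
Qed.

Lemma cCk_1 k U : cCk k U (fun=> 1).
Proof. by split; exact: Ck_cst. Qed.

Lemma cCk_expz k U (w : E -> R[i]) (m : int) : open U ->
  (forall x, U x -> w x != 0) -> cCk k U w -> cCk k U (fun x => w x ^ m).
Proof.
move=> oU w0 Cw.
have Cn (j : nat) : cCk k U (fun x => w x ^+ j).
  elim: j => [|j IH]; first by under eq_fun do rewrite expr0; exact: cCk_1.
  by under eq_fun do rewrite exprS; exact: cCk_mul.
case: m => j; first exact: Cn.
have [rn im] := Cn j.+1.
have nz x : U x -> complex.Re (w x ^+ j.+1) ^+ 2 + complex.Im (w x ^+ j.+1) ^+ 2 != 0.
  move=> Ux; have : w x ^+ j.+1 != 0 by rewrite expf_neq0// w0.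
  rewrite paddr_eq0 ?sqr_ge0// !sqrf_eq0; apply: contra => /andP[/eqP r0 /eqP i0].
  by rewrite eq_complex r0 i0 !eqxx.
have CN : Ck k U (fun x =>
    (complex.Re (w x ^+ j.+1) ^+ 2 + complex.Im (w x ^+ j.+1) ^+ 2)^-1 : R^o).
  apply: Ck_inv => //; under eq_fun do rewrite !expr2.
  by apply: Ck_add => //; exact: Ck_mul.
split.
  have -> : (fun x => complex.Re (w x ^ Negz j) : R^o) = fun x =>
     complex.Re (w x ^+ j.+1) * (complex.Re (w x ^+ j.+1) ^+ 2 + complex.Im (w x ^+ j.+1) ^+ 2)^-1.
    by apply/funext => x; rewrite -[w x ^ Negz j]/((w x ^+ j.+1)^-1); case: (w x ^+ j.+1).
  exact: Ck_mul.
have -> : (fun x => complex.Im (w x ^ Negz j) : R^o) = fun x =>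
   - (complex.Im (w x ^+ j.+1) *
      (complex.Re (w x ^+ j.+1) ^+ 2 + complex.Im (w x ^+ j.+1) ^+ 2)^-1).
  by apply/funext => x; rewrite -[w x ^ Negz j]/((w x ^+ j.+1)^-1); case: (w x ^+ j.+1).
by apply: Ck_opp => //; exact: Ck_mul.
Qed.

Lemma cCk_prod k U (I : Type) (s : seq I) (P : pred I) (w : I -> E -> R[i]) : open U ->
  (forall i, P i -> cCk k U (w i)) -> cCk k U (fun x => \prod_(i <- s | P i) w i x).
Proof.
move=> oU Cw; elim: s => [|i s IH].
  by under eq_fun do rewrite big_nil; exact: cCk_1.
under eq_fun do rewrite big_cons.
by case Pi : (P i) => //; apply: cCk_mul => //; exact: Cw.
Qed.

Lemma cCk_zc k U (B : finType) (h : E -> cspace R B) b : open U ->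
  Ck k U h -> cCk k U (fun x => zc (h x) b).
Proof. by move=> oU Ch; split; exact: Ck_coord. Qed.

Lemma phase_neq0 (B : finType) (z : cspace R B) b : moment z b != 0 -> phase z b != 0.
Proof. by move=> /phase_cis[t ->]; exact: cis_neq0. Qed.

Lemma cCk_phase k U (B : finType) (h : E -> cspace R B) b : open U ->
  (forall x, U x -> 0 < moment (h x) b) -> Ck k U h -> cCk k U (fun x => phase (h x) b).
Proof.
move=> oU m0 Ch.
have Cs : Ck k U (fun x => (Num.sqrt (2 * moment (h x) b))^-1 : R^o).
  apply: Ck_inv => // [x Ux|]; first by rewrite sqrtr_eq0 -ltNge mulr_gt0// m0.
  apply: Ck_sqrt => // [x Ux|]; first by rewrite mulr_gt0// m0.
  by apply: Ck_mul => //; [exact: Ck_cst|exact: Ck_moment].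
by split; apply: Ck_mul => //; exact: Ck_coord.
Qed.

Lemma Ck_cvec k U (B : finType) (w : B -> E -> R[i]) : open U ->
  (forall b, cCk k U (w b)) ->
  Ck k U (fun x => cvec (fun b => complex.Re (w b x)) (fun b => complex.Im (w b x))).
Proof.
move=> oU Cw; apply: Ck_mx => // i j; under eq_fun do rewrite mxE.
by case: (j == ord0); have [] := Cw (enum_val i).
Qed.

End ComplexSmooth.

Section InverseChart.
Context {R : realType} {n : nat} {T : torus R n} (D : delzant T).
Local Notation W := (dual T).
Local Notation F := (facets D).
Implicit Types (xi : W) (z : cspace R F).
Context {v : W} (hv : is_vertex (polytope D) v).
Local Notation A := (facets_at D v).
Implicit Types (f : A) (g : F) (u : cspace R A).

(** The coordinates of a normal are integers, so the floor keeps their values. *)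
Definition acoef (g : F) (f : A) : int := Num.floor (ncoord f (normal g)).

Lemma acoefE g f : (acoef g f)%:~R = ncoord f (normal g) :> R.
Proof.
rewrite /acoef; have [ng _] := normal_primitive g.
by have [m ->] := ncoord_lattice hv f ng; rewrite intrKfloor.
Qed.

(** Each orbit of N in Z_v has a unique point whose coordinates at the facets away
   from v are positive real numbers; these are its coordinates at the facets
   through v. *)
Definition normal_form z : cspace R A :=
  let w f := zc z (val f) * \prod_(g | v \notin facet g) phase z g ^ acoef g f in
  cvec (fun f => complex.Re (w f)) (fun f => complex.Im (w f)).

Lemma zc_normal_form z f :
  zc (normal_form z) f = zc z (val f) * \prod_(g | v \notin facet g) phase z g ^ acoef g f.
Proof. by rewrite zc_cvec; case: (_ * _). Qed.

(** The phase factors make the f-coordinate rotate by the f-coordinate of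
   projF t, which is an integer for t in N. *)
Lemma normal_form_rot (t : {ffun F -> R}) z : groupN D t -> normal_form (rot t z) = normal_form z.
Proof.
move=> Nt; have := zc_rot t z; have := phase_rot t z.
move: (rot t z) => z' phz' zcz'; apply: zcP => f.
apply: etrans (zc_normal_form z' f) _; apply: etrans _ (esym (zc_normal_form z f)).
rewrite zcz'.
have phE g : phase z' g ^ acoef g f = cis (t g * ncoord f (normal g)) * phase z g ^ acoef g f.
  by rewrite phz' expfzMl -acoefE cisMz.
have prodE : \prod_(g | v \notin facet g) phase z' g ^ acoef g f =
    cis (\sum_(g | v \notin facet g) t g * ncoord f (normal g)) *
    \prod_(g | v \notin facet g) phase z g ^ acoef g f.
  transitivity (\prod_(g | v \notin facet g)
      (cis (t g * ncoord f (normal g)) * phase z g ^ acoef g f)).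
    by apply: eq_bigr => g _; exact: phE.
  by apply: etrans (big_split _ _ _ _ _) _; congr (_ * _); exact/esym/cis_sum.
apply: etrans (congr1 (fun p => _ * p) prodE) _.
rewrite mulrACA -cisD.
rewrite -(ncoord_projF hv).
by have [m ->] := ncoord_lattice hv f Nt; rewrite cis_int mul1r.
Qed.

Lemma normal_form_section u : chart_dom u -> normal_form (section_at D v u) = u.
Proof.
move=> hu; apply: zcP => f; rewrite zc_normal_form zc_section_in big1 ?mulr1// => g vg.
have m0 := hu g vg; rewrite /phase (moment_section hv); last by move=> h /hu /ltW.
have [-> ->] : re (section_at D v u) g = rad D g (moment_at D v u) /\ im (section_at D v u) g = 0.
  by have := zc_section_out u vg => -[].
by rewrite mul0r divff ?exp1rz// sqrtr_eq0 -ltNge mulr_gt0.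
Qed.

Lemma moment_normal_form z f : (forall g, v \notin facet g -> 0 < moment z g) ->
  moment (normal_form z) f = moment z (val f).
Proof.
move=> m0; rewrite !momentE zc_normal_form sqnormM; congr (_ / _).
suff -> : sqnorm (\prod_(g | v \notin facet g) phase z g ^ acoef g f) = 1.
  by rewrite mulr1.
apply: (big_ind (fun w => sqnorm w = 1)).
- by rewrite /sqnorm/= expr1n expr0n addr0.
- by move=> w w' w1 w1'; rewrite sqnormM w1 w1' mulr1.
- move=> g vg; have [t ->] := phase_cis (lt0r_neq0 (m0 g vg)).
  by rewrite -cisMz sqnorm_cis.
Qed.

Lemma normal_form_dom z : levelZ_at D v z -> chart_dom (normal_form z) /\
  forall xi, (forall g, moment z g = height g xi) -> moment_at D v (normal_form z) = xi.
Proof.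
rewrite (levelZ_atE hv) => -[Zz /= m0].
have mE xi : (forall g, moment z g = height g xi) -> moment_at D v (normal_form z) = xi.
  by move=> mz; apply: (moment_at_unique hv) => f; rewrite moment_normal_form// mz.
split=> // g vg; have /levelZP[xi mz] := Zz.
by rewrite (mE _ mz) -mz m0.
Qed.

(** Rotate by the opposite of the phases at the facets away from v, and compensate
   at the facets through v to stay in the kernel of projF. *)
Lemma normal_form_orbit z : levelZ_at D v z ->
  exists2 t, groupN D t & rot t z = section_at D v (normal_form z).
Proof.
move=> Zvz; have [_ mE] := normal_form_dom Zvz.
move: Zvz; rewrite (levelZ_atE hv) => -[Zz /= m0].
have /choice[th thE] : forall g, exists t, v \notin facet g -> phase z g = cis t.
  move=> g; have [vg|vg] := boolP (v \in facet g); first by exists 0.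
  by have [t tE] := phase_cis (lt0r_neq0 (m0 g vg)); exists t.
pose t : {ffun F -> R} := [ffun g => if insub g is Some f then
   \sum_(h | v \notin facet h) th h * ncoord (f : A) (normal h) else - th g].
have tin f : t (val f) = \sum_(h | v \notin facet h) th h * ncoord f (normal h).
  by rewrite ffunE valK.
have tout g : v \notin facet g -> t g = - th g.
  by move=> vg; rewrite ffunE insubN.
exists t.
  rewrite /groupN /= (ncoordE hv (projF D t)) big1 ?raddf0// => f _.
  rewrite (ncoord_projF hv) tin -big_split/= big1 ?scale0r// => g vg.
  by rewrite tout// mulNr subrr.
apply: zcP => g; rewrite zc_rot; have [vg|vg] := boolP (v \in facet g).
  have -> : g = val (exist _ g vg : A) by [].
  rewrite zc_section_in zc_normal_form mulrC tin cis_sum; congr (_ * _).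
  by apply: eq_bigr => h vh; rewrite -acoefE cisMz -thE.
have /levelZP[xi mz] := Zz.
rewrite zc_section_out// tout// zc_phase thE// mulrCA -cisD addNr cis0 mulr1.
by rewrite (mE _ mz) /rad -/(height g xi) -mz.
Qed.

Lemma Ck_normal_form k (E : normedModType R) (U : set E) (h : E -> cspace R F) : open U ->
  (forall x, U x -> forall g, v \notin facet g -> 0 < moment (h x) g) ->
  Ck k U h -> Ck k U (fun x => normal_form (h x)).
Proof.
move=> oU m0 Ch; apply: Ck_cvec => // f; apply: cCk_mul => //.
  exact: cCk_zc.
apply: cCk_prod => // g vg; apply: cCk_expz => // [x Ux|].
  by apply: phase_neq0; rewrite gt_eqF// m0.
by apply: cCk_phase => // x Ux; exact: m0.
Qed.

Lemma Ck_section k (E : normedModType R) (U : set E) (h : E -> cspace R A) : open U ->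
  (forall x, U x -> chart_dom (h x)) ->
  Ck k U h -> Ck k U (fun x => section_at D v (h x)).
Proof.
move=> oU hU Ch; apply: Ck_mx => // i j; under eq_fun do rewrite mxE.
have [vg|vg] := boolP (v \in facet (enum_val i)).
  have -> : enum_val i = val (exist (fun g : F => v \in facet g) (enum_val i) vg) by [].
  by rewrite !valK; case: (j == ord0); exact: Ck_coord.
case: (j == ord0); rewrite insubN//; last exact: Ck_cst.
apply: Ck_sqrt => // [x /hU hx|]; first by rewrite mulr_gt0// hx.
apply: Ck_mul => //; first exact: Ck_cst.
apply: (@Ck_comp _ _ _ _ k U setT h (fun u => height (enum_val i) (moment_at D v u))) => //.
  exact: openT.
by apply: (Ck_height_moment_at hv); exact: openT.
Qed.

End InverseChart.

(** * The charts of the atlas at the vertices *)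

Section RowCoordinates.
Context {R : realType} {n : nat} {B : finType} (e : 'I_n -> B) (e' : B -> 'I_n).

Lemma half_ord_proof (i : 'I_(2 * n)) : (i./2 < n)%N.
Proof. by rewrite ltn_half_double -mul2n. Qed.

Definition half_ord i : 'I_n := Ordinal (half_ord_proof i).

Lemma re_ord_proof (j : 'I_n) : (j.*2 < 2 * n)%N.
Proof. by rewrite mul2n ltn_double. Qed.

Lemma im_ord_proof (j : 'I_n) : (j.*2.+1 < 2 * n)%N.
Proof. by rewrite mul2n ltn_Sdouble. Qed.

(** The coordinate at e j is found at the indices 2j (real part) and 2j + 1
   (imaginary part). *)
Definition row_of (u : cspace R B) : 'rV[R]_(2 * n) :=
  \row_i (if odd i then im u (e (half_ord i)) else re u (e (half_ord i))).

Definition of_row (y : 'rV[R]_(2 * n)) : cspace R B :=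
  cvec (fun b => y ord0 (Ordinal (re_ord_proof (e' b))))
       (fun b => y ord0 (Ordinal (im_ord_proof (e' b)))).

Lemma row_ofK : cancel e' e -> cancel row_of of_row.
Proof.
move=> eK u; apply: cspaceP => b; rewrite ?re_cvec ?im_cvec mxE /= ?odd_double /=.
  rewrite (_ : half_ord _ = e' b) ?eK//; apply: val_inj => /=; exact: doubleK.
rewrite (_ : half_ord _ = e' b) ?eK//; apply: val_inj => /=; exact: uphalf_double.
Qed.

Lemma of_rowK : cancel e e' -> cancel of_row row_of.
Proof.
move=> eK y; apply/rowP => i; rewrite mxE re_cvec im_cvec eK.
have := odd_double_half i; case: ifP => oi iE; congr (y _ _); apply: val_inj => /=.
  by rewrite -[RHS]iE add1n.
by rewrite -[RHS]iE add0n.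
Qed.

Lemma Ck_row_of k (E : normedModType R) (U : set E) h : open U ->
  Ck k U h -> Ck k U (fun x => row_of (h x)).
Proof.
move=> oU Ch; apply: Ck_mx => // i j; under eq_fun do rewrite mxE.
by case: (odd j); exact: Ck_coord.
Qed.

Lemma Ck_of_row k (E : normedModType R) (U : set E) h : open U ->
  Ck k U h -> Ck k U (fun x => of_row (h x)).
Proof.
move=> oU Ch; apply: Ck_mx => // i j; under eq_fun do rewrite mxE.
by case: (j == ord0); exact: Ck_coord.
Qed.

End RowCoordinates.

Section QuotientMaps.
Context {R : realType} {n : nat} {T : torus R n} (D : delzant T).

Lemma projM_comp_continuous (X : topologicalType) (h : X -> cspace R (facets D)) x :
  {for x, continuous h} -> (\forall y \near x, levelZ D (h y)) ->
  {for x, continuous (projM D \o h)}.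
Proof.
move=> ch hZ B; rewrite nbhsE => -[A [oA Ax] AB].
have [U oU UE] := (open_delzantP A).1 oA.
have : nbhs x (h @^-1` U).
  have hxU : nbhs (h x) U -> nbhs x (h @^-1` U) by exact: ch.
  apply: hxU; apply: open_nbhs_nbhs; split=> //.
  have : (levelZ D `&` projM D @^-1` A) (h x).
    by split=> //; exact: (@nbhs_singleton _ x (fun y => levelZ D (h y)) hZ).
  by rewrite UE => -[].
move=> hU; suff : nbhs x ((projM D \o h) @^-1` B) by [].
apply: filterS (filterI hU hZ) => y [Uy Zy]; apply: AB.
have : (levelZ D `&` U) (h y) by split.
by rewrite -UE => -[].
Qed.

Lemma projM_within_continuous (S : set (cspace R (facets D))) :
  S `<=` levelZ D -> {within S, continuous (projM D)}.
Proof.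
move=> SZ; apply/continuousP => A oA.
have [U oU UE] := (open_delzantP A).1 oA.
apply/open_subspaceP; exists U => //.
apply/seteqP; split=> z [h Sz]; split=> //; last first.
  have : (levelZ D `&` projM D @^-1` A) z by split=> //; exact: SZ.
  by rewrite UE => -[].
have : (levelZ D `&` U) z by split=> //; exact: SZ.
by rewrite -UE => -[].
Qed.

Lemma continuous_at_within (X Y : topologicalType) (A : set X) (h : X -> Y) :
  (forall x, A x -> {for x, continuous h}) -> {within A, continuous h}.
Proof.
move=> ch; apply/subspace_continuousP => x Ax.
exact: cvg_within_filter (ch x Ax).
Qed.

End QuotientMaps.

Section AtlasChart.
Context {R : realType} {n : nat} {T : torus R n} (D : delzant T).
Local Notation W := (dual T).
Local Notation F := (facets D).
Local Notation M := (delzant_space D).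
Implicit Types (xi : W) (z : cspace R F) (m : M).
Context {v : W} (hv : is_vertex (polytope D) v).
Local Notation A := (facets_at D v).
Implicit Types (f : A) (g : F) (u : cspace R A).

Definition psi_inv m : cspace R A := normal_form (val (repr m)).

Lemma psi_inv_projM z : levelZ D z -> psi_inv (projM D z) = normal_form z.
Proof.
move=> Zz; rewrite /psi_inv; set m := projM D z.
have Zr : levelZ D (val (repr m)) := set_valP (repr m).
have : projM D z = projM D (val (repr m)).
  rewrite (projM_inZ Zr) -/m -[LHS]reprK; congr (\pi_(M)%qT _); exact: val_inj.
by move=> /(projM_eq Zz Zr)[t Nt ->]; exact: normal_form_rot.
Qed.

Lemma levelZ_at_rot t z : levelZ_at D v (rot t z) <-> levelZ_at D v z.
Proof.
rewrite (levelZ_atE hv); split=> -[/levelZP[xi mz] h]; split.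
- by apply/levelZP; exists xi => f; rewrite -mz moment_rot.
- by move=> g /h; rewrite moment_rot.
- by apply/levelZP; exists xi => f; rewrite -mz moment_rot.
- by move=> g /h; rewrite moment_rot.
Qed.

Lemma delzant_space_atP z : levelZ D z ->
  delzant_space_at D v (projM D z) <-> levelZ_at D v z.
Proof.
move=> Zz; split=> [[z' Zz']|]; last by exists z.
move=> /(projM_eq Zz'.2 Zz)[t _ ->]; exact/levelZ_at_rot.
Qed.

Lemma levelZ_at_section u : chart_dom u -> levelZ_at D v (section_at D v u).
Proof.
move=> hu; have Zs : levelZ D (section_at D v u).
  by apply: (levelZ_section hv) => g /hu /ltW.
by split=> //=; rewrite /preimage /= rho_section (domUE hv).
Qed.

Lemma psi_inv_psi u : chart_dom u -> psi_inv (psi D v u) = u.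
Proof.
move=> hu; rewrite psi_inv_projM ?normal_form_section//.
by have [] := levelZ_at_section hu.
Qed.

Lemma psi_psi_inv m : delzant_space_at D v m ->
  chart_dom (psi_inv m) /\ psi D v (psi_inv m) = m.
Proof.
move=> [z Zvz <-]; have Zz := Zvz.2; rewrite psi_inv_projM//.
have [hd _] := normal_form_dom hv Zvz; split=> //.
have [t Nt tz] := normal_form_orbit hv Zvz.
rewrite /psi /= -tz; apply/esym/projM_eq => //; first exact: levelZ_rot.
by exists t.
Qed.

Lemma psi_image : psi D v @` domU D v = delzant_space_at D v.
Proof.
rewrite (domUE hv); apply/seteqP; split=> [_ [u hu <-]|m hm].
  by exists (section_at D v u) => //; exact: levelZ_at_section.
by have [hd e] := psi_psi_inv hm; exists (psi_inv m).
Qed.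

Lemma Ck_rho k (E : normedModType R) (U : set E) (h : E -> cspace R F) : open U ->
  Ck k U h -> Ck k U (fun x => rho D v (h x)).
Proof.
move=> oU Ch; apply: Ck_mx => // i j; under eq_fun do rewrite mxE.
by case: (j == ord0); exact: Ck_coord.
Qed.

Lemma open_delzant_space_at : open (delzant_space_at D v).
Proof.
apply/open_delzantP; exists (rho D v @^-1` domU D v).
  apply: open_comp; last exact: open_interior.
  by move=> z _; exact: (@Ck_rho 0 _ setT id openT (@Ck_id _ _ _ _) z).
apply/seteqP; split=> z [Zz h]; split=> //.
  by have [] := (delzant_space_atP Zz).1 h.
by apply/delzant_space_atP.
Qed.

Definition near_vertex : set (cspace R F) :=
  [set z | forall g, v \notin facet g -> 0 < moment z g].

Lemma open_near_vertex : open near_vertex.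
Proof. exact: open_pos_family (@continuous_moment R F). Qed.

Context (e : 'I_n -> A) (e' : A -> 'I_n) (eK : cancel e e') (e'K : cancel e' e).

Definition vertex_chart : chart R M (2 * n) :=
  Chart (delzant_space_at D v) (row_of e \o psi_inv) (psi D v \o of_row e').

Lemma cimg_vertex_chart : cimg vertex_chart = of_row e' @^-1` @chart_dom _ _ _ D v.
Proof.
apply/seteqP; split=> [_ [m hm <-]|y hy] /=.
  by rewrite /preimage/= row_ofK//; have [] := psi_psi_inv hm.
exists (psi D v (of_row e' y)) => /=; last by rewrite psi_inv_psi// of_rowK.
by exists (section_at D v (of_row e' y)) => //; exact: levelZ_at_section.
Qed.

Lemma open_cimg_vertex_chart : open (cimg vertex_chart).
Proof.
rewrite cimg_vertex_chart; apply: open_comp; last exact: open_chart_dom.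
move=> y _; apply: (@Ck_of_row R n A e' 0 _ setT id openT) => //.
by move=> x _.
Qed.

Lemma Ck_row_normal_form k : Ck k near_vertex (row_of e \o @normal_form _ _ _ D v).
Proof.
apply: Ck_row_of; first exact: open_near_vertex.
by apply: (@Ck_normal_form _ _ _ _ _ k _ near_vertex id); [exact: open_near_vertex| |exact: Ck_id].
Qed.

Lemma Ck_section_of_row k : Ck k (cimg vertex_chart) (section_at D v \o of_row e').
Proof.
have oc := open_cimg_vertex_chart; apply: (Ck_section hv) => //.
  by move=> y; rewrite cimg_vertex_chart.
apply: Ck_of_row => //.
by apply: (@Ck_linear _ _ _ _ _ idfun) => x.
Qed.

Lemma levelZ_at_near z : levelZ_at D v z -> near_vertex z.
Proof. by rewrite (levelZ_atE hv) => -[]. Qed.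

(** Composed with the projection, the chart is normal_form, which is smooth on an
   open set of the ambient space; section_at lifts its inverse smoothly. *)
Lemma vertex_chart_atlas : delzant_atlas D vertex_chart.
Proof.
have is_chart_v : is_chart vertex_chart.
  split.
  - exact: open_delzant_space_at.
  - exact: open_cimg_vertex_chart.
  - by move=> m hm /=; rewrite row_ofK//; have [] := psi_psi_inv hm.
  - apply: continuous_at_within => m hm B.
    rewrite nbhsE => -[C [oC Cm] CB].
    suff : open (delzant_space_at D v `&` cmap vertex_chart @^-1` C).
      move=> oX; apply: filterS (open_nbhs_nbhs (conj oX (conj hm Cm))) => x [_].
      exact: CB.
    apply/open_delzantP.
    exists (near_vertex `&` (row_of e \o @normal_form _ _ _ D v) @^-1` C).
      rewrite openE => z [hz Cz]; apply: filterI.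
        exact: open_nbhs_nbhs (conj open_near_vertex hz).
      by apply: (@Ck_row_normal_form 0 z hz); exact: open_nbhs_nbhs.
    have key z : levelZ D z ->
        (delzant_space_at D v `&` cmap vertex_chart @^-1` C) (projM D z) <->
        (near_vertex `&` (row_of e \o @normal_form _ _ _ D v) @^-1` C) z.
      move=> Zz; rewrite /preimage/=; rewrite psi_inv_projM; last exact: Zz.
      split=> -[h hC]; split; [|exact: hC| |exact: hC].
        by apply: levelZ_at_near; apply/delzant_space_atP.
      by apply/delzant_space_atP; [exact: Zz|rewrite (levelZ_atE hv); split].
    apply/seteqP; split=> z [Zz hz].
      by split; [exact: Zz|exact: (key z Zz).1 hz].
    by split; [exact: Zz|exact: (key z Zz).2 hz].
  - apply: continuous_at_within => y hy.
    apply: (@projM_comp_continuous _ _ _ D _ (section_at D v \o of_row e')).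
      exact: (@Ck_section_of_row 0 y hy).
    have hyn := open_nbhs_nbhs (conj open_cimg_vertex_chart hy).
    apply: filterS hyn => x; rewrite cimg_vertex_chart => hx.
    by have [] := levelZ_at_section hx.
split=> //.
- move=> z [Zz hz]; exists near_vertex, (row_of e \o @normal_form _ _ _ D v).
  split; first exact: open_near_vertex.
  + by apply/levelZ_at_near/delzant_space_atP.
  + by move=> k; exact: Ck_row_normal_form.
  + by move=> x; rewrite inE => -[_ [Zx _]] /=; rewrite psi_inv_projM.
- move=> y hy; exists (cimg vertex_chart), (section_at D v \o of_row e').
  split.
  + exact: open_cimg_vertex_chart.
  + by split.
  + by move=> k; exact: Ck_section_of_row.
  + move=> _ [x hx <-]; rewrite cimg_vertex_chart in hx.
    by have [] := levelZ_at_section hx.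
  + by move=> x _.
Qed.

Lemma psi_diffeo : diffeo_onto_open (delzant_atlas D) (domU D v) (psi D v).
Proof.
have oU : open (domU D v) by exact: open_interior.
split.
- exact: oU.
- by rewrite psi_image; exact: open_delzant_space_at.
- move=> u hu; exists vertex_chart, (domU D v); split.
  + exact: vertex_chart_atlas.
  + exact: oU.
  + by split.
  + by rewrite psi_image.
  + move=> k; apply: (@Ck_eq _ _ _ k _ (row_of e) _ oU) => [x|].
      by rewrite (domUE hv) => hx; rewrite /= psi_inv_psi.
    by apply: (@Ck_row_of _ _ _ _ _ _ _ id); [exact: oU|exact: Ck_id].
- exists psi_inv; split; first by move=> u; rewrite (domUE hv); exact: psi_inv_psi.
  move=> m hm; exists vertex_chart; split; first exact: vertex_chart_atlas.
  + by move: hm; rewrite psi_image.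
  + by rewrite psi_image.
  + have oc := open_cimg_vertex_chart.
    move=> k; apply: (@Ck_eq _ _ _ k _ (of_row e') _ oc) => [x|].
      by rewrite cimg_vertex_chart => hx; rewrite /= psi_inv_psi.
    apply: (@Ck_of_row _ _ _ _ _ _ _ id); first exact: oc.
    by apply: (@Ck_linear _ _ _ _ _ idfun) => x.
Qed.

End AtlasChart.

(** * Compactness, connectedness and density *)

Lemma mx_bounded_closed_compact (R : realType) p q (K : set 'M[R]_(p, q)) (M : R) :
  closed K -> (forall z, K z -> forall i j, `|z i j| <= M) -> compact K.
Proof.
move=> cK bK.
have cont : continuous (@vec_mx R p q : 'rV[R]_(p * q) -> 'M[R]_(p, q)).
  move=> y; apply: (@Ck_mx R _ 0 setT p q vec_mx openT) => // i j.
  under eq_fun do rewrite mxE.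
  by move=> x _; exact: coord_continuous.
have -> : K = vec_mx @` (vec_mx @^-1` K).
  apply/seteqP; split=> [z Kz|_ [y Ky <-]//].
  by exists (mxvec z); rewrite /preimage/= mxvecK.
apply: continuous_compact; first exact: continuous_subspaceT.
apply: bounded_closed_compact; last first.
  by apply: preimage_closed cK => y _; exact: cont.
exists `|M|; split; first by rewrite num_real.
move=> N MN y Ky; rewrite /= /Num.Def.normr/= mx_normrE (bigmax_le _ _)//.
  by rewrite (le_trans _ (ltW MN)).
move=> [i k] _ /=; rewrite (ord1 i); case/mxvec_indexP: k => i' j'.
have := bK _ Ky i' j'; rewrite mxE => h.
by rewrite (le_trans h)// (le_trans (ler_norm M))// ltW.
Qed.

Section Global.
Context {R : realType} {n : nat} {T : torus R n} (D : delzant T).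
Local Notation W := (dual T).
Local Notation F := (facets D).
Local Notation M := (delzant_space D).
Implicit Types (xi v : W) (z : cspace R F) (m : M) (f g : F).

Lemma closed_levelZ : closed (levelZ D).
Proof.
have -> : levelZ D = \bigcap_(t in lie_n D)
    [set z | \sum_f moment z f * t f = \sum_f offset f * t f].
  by apply/seteqP; split=> z h t; exact: h.
apply: closed_bigI => t _.
apply: (@preimage_closed _ _ (fun z => \sum_f moment z f * t f) [set x | x = _]).
  move=> z _; apply: (@Ck_sum R (cspace R F) R^o F (index_enum F) xpredT 0 setT
    (fun f z => moment z f * t f) openT) => // f _.
  apply: Ck_mul; [exact: openT| |exact: Ck_cst].
  by apply: Ck_moment; [exact: openT|exact: Ck_id].
exact: closed_eq.
Qed.

(** On the level set |z_f|^2 / 2 is the height of f at a point of the polytope,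
   hence bounded. *)
Lemma compact_levelZ : compact (levelZ D).
Proof.
have /choice[N NP] := @height_bounded _ _ _ D.
apply: (@mx_bounded_closed_compact _ _ _ _ (\sum_g (2 * `|N g| + 1)) closed_levelZ).
move=> z /levelZP[xi mz] i j.
have Pxi := levelZ_polytope mz.
set g := enum_val i.
apply: (@le_trans _ _ (2 * `|N g| + 1)); last first.
  by rewrite (bigD1 g)//= lerDl sumr_ge0// => h _; rewrite addr_ge0// mulr_ge0.
have Nz : z i j ^+ 2 <= 2 * `|N g|.
  have := le_trans (NP g _ Pxi) (ler_norm _); rewrite -mz /moment /re /im enum_valK.
  have [->|->] : j = ord0 \/ j = ord_max.
    by case: j => -[|[|//]] jp; [left|right]; exact: val_inj.
    by have := sqr_ge0 (z i ord_max); lra.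
  by have := sqr_ge0 (z i ord0); lra.
rewrite -real_normK ?num_real// in Nz; have := normr_ge0 (z i j).
by move: (`|z i j|) Nz => x; nra.
Qed.

Lemma levelZ_polar z xi : (forall g, moment z g = height g xi) ->
  exists t : F -> R, forall g, zc z g = Complex (Num.sqrt (2 * height g xi)) 0 * cis (t g).
Proof.
move=> mz; suff /choice[t tE] : forall g, exists t,
    zc z g = Complex (Num.sqrt (2 * height g xi)) 0 * cis t by exists t.
move=> g; have [m0|m0] := eqVneq (moment z g) 0; last first.
  by have [t tE] := phase_cis m0; exists t; rewrite -tE -mz -zc_phase.
exists 0; move/eqP: (m0); rewrite moment_eq0 => /eqP ->.
by rewrite -mz m0 mulr0 sqrtr0 mul0r.
Qed.

(** Polar coordinates join any two points of the level set by a path, above a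
   segment in the polytope. *)
Definition polar_path (t t' : F -> R) xi xi' (s : R) : cspace R F :=
  let w g := Complex (Num.sqrt (2 * height g (xi + s *: (xi' - xi)))) 0 *
             cis (t g + s * (t' g - t g)) in
  cvec (fun g => complex.Re (w g)) (fun g => complex.Im (w g)).

Lemma zc_polar_path t t' xi xi' s g : zc (polar_path t t' xi xi' s) g =
  Complex (Num.sqrt (2 * height g (xi + s *: (xi' - xi)))) 0 * cis (t g + s * (t' g - t g)).
Proof. by rewrite zc_cvec; case: (_ * _). Qed.

Lemma moment_polar_path t t' xi xi' s : 0 <= s <= 1 -> polytope D xi -> polytope D xi' ->
  forall g, moment (polar_path t t' xi xi' s) g = height g (xi + s *: (xi' - xi)).
Proof.
move=> s01 Pxi Pxi' g; rewrite momentE zc_polar_path sqnormM sqnorm_cis mulr1.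
rewrite /sqnorm/= expr0n addr0 sqr_sqrtr; first by rewrite mulrC mulKf ?pnatr_eq0.
by rewrite mulr_ge0//; apply/polytope_ge0/polytope_segment.
Qed.

Lemma continuous_polar_path t t' xi xi' : continuous (polar_path t t' xi xi').
Proof.
have ch g : continuous (fun s : R => height g (xi + s *: (xi' - xi))).
  have -> : (fun s : R => height g (xi + s *: (xi' - xi))) =
      fun s : R => (1 - s) * height g xi + s * height g xi'.
    by apply/funext => s; rewrite height_affine.
  move=> s; apply: cvgD; apply: cvgM; try exact: cvg_cst; last exact: cvg_id.
  by apply: cvgB; [exact: cvg_cst|exact: cvg_id].
have cr g : continuous (fun s : R => Num.sqrt (2 * height g (xi + s *: (xi' - xi)))).
  move=> s; apply: (@continuous_comp _ _ _
    (fun s : R => 2 * height g (xi + s *: (xi' - xi))) Num.sqrt);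
    last exact: sqrt_continuous.
  by apply: cvgM; [exact: cvg_cst|exact: ch].
have ca g : continuous (fun s : R => 2 * pi * (t g + s * (t' g - t g))).
  move=> s; apply: cvgM; first exact: cvg_cst.
  apply: cvgD; first exact: cvg_cst.
  by apply: cvgM; [exact: cvg_id|exact: cvg_cst].
have cc g : continuous (fun s : R => cos (2 * pi * (t g + s * (t' g - t g)))).
  by move=> x; apply: (@continuous_comp _ _ _ (fun s : R => 2 * pi * (t g + s * (t' g - t g))) cos);
    [exact: ca|exact: continuous_cos].
have cs g : continuous (fun s : R => sin (2 * pi * (t g + s * (t' g - t g)))).
  by move=> x; apply: (@continuous_comp _ _ _ (fun s : R => 2 * pi * (t g + s * (t' g - t g))) sin);
    [exact: ca|exact: continuous_sin].
move=> s; apply: (@Ck_mx R R^o 0 setT _ _ (polar_path t t' xi xi') openT) => // i j s' _.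
rewrite /polar_path; set h := (X in {for _, continuous X}).
have -> : h = fun s => Num.sqrt (2 * height (enum_val i) (xi + s *: (xi' - xi))) *
    (if j == ord0 then cos (2 * pi * (t (enum_val i) + s * (t' (enum_val i) - t (enum_val i))))
     else sin (2 * pi * (t (enum_val i) + s * (t' (enum_val i) - t (enum_val i))))).
  apply/funext => x; rewrite /h mxE /cis mulcE /=.
  by case: (j == ord0); rewrite mul0r ?subr0 ?addr0.
by case: (j == ord0); apply: cvgM; [exact: cr|exact: cc|exact: cr|exact: cs].
Qed.

End Global.

Section FacetPreimage.
Context {R : realType} {n : nat} {T : torus R n} (D : delzant T).
Local Notation W := (dual T).
Local Notation F := (facets D).
Local Notation M := (delzant_space D).
Implicit Types (xi v : W) (z : cspace R F) (m : M) (f g : F).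

Lemma facet_moment_T f z : levelZ D z ->
  facet f (moment_T D (projM D z)) <-> zc z f = 0.
Proof.
move=> Zz; have /levelZP[xi mz] := Zz.
rewrite (moment_T_projM Zz mz) facetE.
have mE : (zc z f = 0) <-> (height f xi = 0).
  by rewrite -mz; split=> /eqP h; apply/eqP; rewrite ?moment_eq0// -moment_eq0.
split=> [[_ /mE]//|/mE h]; split=> //; exact: levelZ_polytope mz.
Qed.

Definition facet_levelZ f : set (cspace R F) := levelZ D `&` [set z | zc z f = 0].

Lemma facet_preimageE f : moment_T D @^-1` facet f = projM D @` facet_levelZ f.
Proof.
apply/seteqP; split=> [m|_ [z [Zz z0] <-]]; last exact/(facet_moment_T f Zz).
have [z Zz <-] := projM_surj m => h.
by exists z => //; split=> //; apply/(facet_moment_T f Zz).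
Qed.

Lemma closed_zc_eq0 f : closed [set z : cspace R F | zc z f = 0].
Proof.
have -> : [set z : cspace R F | zc z f = 0] = (fun z => moment z f) @^-1` [set x | x = 0].
  apply/seteqP; split=> z /= /eqP h; apply/eqP; first by rewrite moment_eq0.
  by rewrite -moment_eq0.
apply: preimage_closed; last exact: closed_eq.
by move=> z _; exact: continuous_moment.
Qed.

Lemma compact_facet_preimage f : compact (moment_T D @^-1` facet f).
Proof.
rewrite facet_preimageE; apply: continuous_compact.
  by apply: projM_within_continuous => z [].
apply: compact_closedI; [exact: compact_levelZ|exact: closed_zc_eq0].
Qed.

(** Along a polar path, the height of f is affine, so it stays 0 if it is 0 at both
   ends. *)
Lemma connected_facet_levelZ f : connected (facet_levelZ f).
Proof.
have [[z Sz]|nS] := pselect (exists z, facet_levelZ f z); last first.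
  have -> : facet_levelZ f = set0.
    by apply/seteqP; split=> // z Sz; apply: nS; exists z.
  exact: connected0.
have /levelZP[xi mz] := Sz.1.
have [t tE] := levelZ_polar mz; have Pxi := levelZ_polytope mz.
have hf y yi : facet_levelZ f y -> (forall g, moment y g = height g yi) -> height f yi = 0.
  by move=> [_ /= y0] my; apply/eqP; rewrite -my moment_eq0 y0.
pose path (y : cspace R F) (K : set (cspace R F)) :=
  [/\ connected K, K z, K y & K `<=` facet_levelZ f].
have /choice[K KP] : forall y, exists K, facet_levelZ f y -> path y K.
  move=> y; have [Sy|] := pselect (facet_levelZ f y); last by exists set0.
  have /levelZP[yi my] := Sy.1.
  have [s sE] := levelZ_polar my; have Pyi := levelZ_polytope my.
  have at0 : polar_path t s xi yi 0 = z.
    by apply: zcP => g; rewrite zc_polar_path scale0r !addr0 mul0r addr0 tE.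
  have at1 : polar_path t s xi yi 1 = y.
    apply: zcP => g; rewrite zc_polar_path scale1r addrC subrK mul1r sE.
    by rewrite [t g + _]addrC subrK.
  exists (polar_path t s xi yi @` `[0, 1]) => _; split.
  - apply: connected_continuous_connected; first exact: segment_connected.
    by apply: continuous_subspaceT => r; exact: continuous_polar_path.
  - by exists 0; [rewrite /= in_itv/= lexx ler01|].
  - by exists 1; [rewrite /= in_itv/= lexx ler01|].
  - move=> _ [r /= /[!in_itv]/= r01 <-].
    have mr := moment_polar_path t s r01 Pxi Pyi.
    split; first by apply/levelZP; eexists; exact: mr.
    apply/eqP; rewrite /= -moment_eq0 mr height_affine.
    by rewrite (hf _ _ Sz mz) (hf _ _ Sy my) !mulr0 addr0.
have -> : facet_levelZ f = \bigcup_(y in facet_levelZ f) K y.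
  apply/seteqP; split=> [y Sy|y [y' Sy']]; first by exists y => //; have [] := KP y Sy.
  by have [_ _ _] := KP y' Sy'; exact.
apply: bigcup_connected; last by move=> y Sy; have [] := KP y Sy.
by exists z => y Sy; have [] := KP y Sy.
Qed.

Lemma connected_facet_preimage f : connected (moment_T D @^-1` facet f).
Proof.
rewrite facet_preimageE; apply: connected_continuous_connected.
  exact: connected_facet_levelZ.
by apply: projM_within_continuous => z [].
Qed.

(** Follow a polar path above the segment to a point interior to the polytope: all
   its points after time 0 have nonzero coordinates. *)
Lemma dense_delzant_space_at v : is_vertex (polytope D) v ->
  dense (delzant_space_at D v).
Proof.
move=> hv B [m Bm] oB; have [z Zz zm] := projM_surj m.
have /levelZP[xi mz] := Zz.
have [t tE] := levelZ_polar mz; have Pxi := levelZ_polytope mz.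
have [xi' Pxi' pos] := polytope_inner D.
pose h := polar_path t t xi xi'.
have h0 : h 0 = z.
  by apply: zcP => g; rewrite zc_polar_path scale0r !addr0 mul0r addr0 tE.
have [U oU UE] := (open_delzantP B).1 oB.
have Uz : U z.
  have : (levelZ D `&` projM D @^-1` B) z by split=> //=; rewrite /preimage/= zm.
  by rewrite UE => -[].
have /nbhs_ballP[r /= r0 rU] : nbhs (0 : R) (h @^-1` U).
  have hU : nbhs (h 0) U -> nbhs (0 : R) (h @^-1` U) by exact: continuous_polar_path.
  by apply: hU; rewrite h0; exact: open_nbhs_nbhs.
pose s := Num.min (r / 2) 1.
have s0 : 0 < s by rewrite lt_min ltr01 andbT divr_gt0.
have s1 : s <= 1 by rewrite ge_min lexx orbT.
have sr : s <= r / 2 by rewrite ge_min lexx.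
have s01 : 0 <= s <= 1 by rewrite ltW.
have ms := moment_polar_path t t s01 Pxi Pxi'.
have Zs : levelZ D (h s) by apply/levelZP; eexists; exact: ms.
exists (projM D (h s)); split.
  have : (levelZ D `&` U) (h s).
    split=> //; apply: rU; rewrite -ball_normE /= sub0r normrN gtr0_norm//; lra.
  by rewrite -UE => -[].
exists (h s) => //; rewrite (levelZ_atE hv); split=> // g _.
rewrite /h ms height_affine ltr_wpDl//; last by rewrite mulr_gt0.
by rewrite mulr_ge0 ?subr_ge0//; exact: polytope_ge0.
Qed.

End FacetPreimage.

(** * Maximality *)

(** The inverse of a diffeomorphism onto an open set is continuous, so the
   diffeomorphism maps open sets to open sets. *)
Lemma diffeo_open_map (R : realType) (M : topologicalType) (k : nat)
    (A : atlas R M k) (E : normedModType R) (U : set E) (g : E -> M) (B : set E) :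
  (forall c, A c -> is_chart c) ->
  diffeo_onto_open A U g -> open B -> B `<=` U -> open (g @` B).
Proof.
move=> charts [oU ogU _ [h [hg hs]]] oB BU.
have -> : g @` B = [set m | (g @` U) m /\ B (h m)].
  apply/seteqP; split=> [_ [u Bu <-]|_ [[u Uu <-]]].
    by split; [exists u => //; exact: BU|rewrite hg//; exact: BU].
  by rewrite hg// => Bu; exists u.
rewrite openE => m [gm Bm]; rewrite /interior/=.
have [c [Ac cm cU Ch]] := hs m gm.
have [ocd oci cK ccm _] := charts c Ac.
move: ccm; rewrite continuous_open_subspace// => ccm.
have mapm : {for m, continuous (cmap c)} by apply: ccm; rewrite inE.
have nV : nbhs (cmap c m) (cimg c `&` (h \o cinv c) @^-1` B).
  apply: filterI; first by apply: open_nbhs_nbhs; split=> //; exists m.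
  have hB : nbhs ((h \o cinv c) (cmap c m)) B -> nbhs (cmap c m) ((h \o cinv c) @^-1` B).
    by apply: (Ch 0); exists m.
  by apply: hB; rewrite /= cK//; exact: open_nbhs_nbhs.
have := mapm _ nV => /= nm.
have nd : nbhs m (cdom c) by exact: open_nbhs_nbhs.
apply: filterS (filterI nd nm) => x [cx [_ Bx]]; split; first exact: cU.
by move: Bx; rewrite /preimage/= cK.
Qed.

Section Maximality.
Context {R : realType} {n : nat} {T : torus R n} (D : delzant T).
Local Notation W := (dual T).
Local Notation F := (facets D).
Context {v : W} (hv : is_vertex (polytope D) v).
Local Notation A := (facets_at D v).

Lemma enum_facets_at : exists (e : 'I_n -> A) (e' : A -> 'I_n),
  cancel e e' /\ cancel e' e.
Proof.
have cA := card_facets_at hv.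
exists (fun i => enum_val (cast_ord (esym cA) i)), (fun a => cast_ord cA (enum_rank a)).
by split=> x; rewrite ?enum_valK ?cast_ordKV ?cast_ordK ?enum_rankK.
Qed.

(** In the chart for such an enumeration, f has the last two real coordinates. *)
Lemma enum_facets_at_last (f : A) : exists (e : 'I_n -> A) (e' : A -> 'I_n),
  [/\ cancel e e', cancel e' e & (e' f).+1 = n].
Proof.
have [e [e' [eK e'K]]] := enum_facets_at.
have n0 : (0 < n)%N by exact: leq_ltn_trans (ltn_ord (e' f)).
have ln : (n.-1 < n)%N by rewrite prednK.
pose l := Ordinal ln; pose s := tperm (e' f) l.
exists (e \o s), (s \o e'); split.
- by move=> i /=; rewrite eK tpermK.
- by move=> a /=; rewrite tpermK e'K.
- by rewrite /= tpermL /= prednK.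
Qed.

Lemma closed_rho_levelZ : closed (rho D v @` levelZ D).
Proof.
apply: compact_closed; first exact: norm_hausdorff.
apply: continuous_compact; last exact: compact_levelZ.
apply: continuous_subspaceT => z.
exact: (@Ck_rho _ _ _ D v 0 _ setT id openT (@Ck_id _ _ _ _) z).
Qed.

(** The image of any nonempty open part of the domain of an extension meets the
   dense set M_v, so by injectivity the domain of psi is dense in that of the
   extension, which is thus contained in the closed set rho_v(Z), hence in its
   interior. *)
Lemma psi_maximal : maximal_diffeo (delzant_atlas D) (domU D v) (psi D v).
Proof.
have [e [e' [eK e'K]]] := enum_facets_at.
split; first exact: (psi_diffeo hv eK e'K).
move=> U' g' dg' UU' g'E; apply/seteqP; split=> //.
have [oU' _ _ [h [hg _]]] := dg'.
rewrite /domU -open_subsetE// => u U'u.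
apply: closed_rho_levelZ => B; rewrite nbhsE => -[C [oC Cu] CB].
have oCU : open (C `&` U') by exact: openI.
have oim : open (g' @` (C `&` U')).
  apply: (diffeo_open_map _ dg' oCU); last by move=> ? [].
  by move=> c [].
have [|m [[u2 [Cu2 U'u2] u2m]]] := dense_delzant_space_at hv _ oim.
  by exists (g' u), u.
rewrite -(psi_image hv) => -[u1 Uu1 u1m].
have u12 : u1 = u2.
  rewrite -(hg _ (UU' _ Uu1)) -(hg _ U'u2); congr h.
  by rewrite u2m -u1m g'E// inE.
exists u2; split; last exact: CB.
by rewrite -u12; exact: interior_subset Uu1.
Qed.

End Maximality.

(** * Slice charts along the preimage of a facet *)

Section FacetSubmanifold.
Context {R : realType} {n : nat} {T : torus R n} (D : delzant T).
Local Notation W := (dual T).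
Local Notation F := (facets D).
Local Notation M := (delzant_space D).
Implicit Types (xi v : W) (z : cspace R F) (m : M) (f g : F).

(** The set Z_v contains z as soon as v lies on all the facets containing the
   momentum of z, and these are the facets where a coordinate of z vanishes. *)
Lemma vertex_near z xi : levelZ D z -> (forall g, moment z g = height g xi) ->
  exists2 v, is_vertex (polytope D) v &
    levelZ_at D v z /\ forall g, zc z g = 0 -> v \in facet g.
Proof.
move=> Zz mz; have Pxi := levelZ_polytope mz.
have [v hv below] := vertex_below Pxi; exists v => //.
have h g : zc z g = 0 -> v \in facet g.
  move=> z0; rewrite inE; apply: below; rewrite facetE; split=> //=.
  by apply/eqP; rewrite -mz moment_eq0 z0.
split=> //; rewrite (levelZ_atE hv); split=> // g vg.
rewrite lt_def moment_ge0 andbT moment_eq0; apply: contraNneq vg => z0; exact: h.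
Qed.

(** In the chart at a vertex of the facet f, the preimage of f is defined by the
   vanishing of the complex coordinate at f. *)
Lemma submanifold_facet_preimage f :
  submanifold (delzant_atlas D) 2 (moment_T D @^-1` facet f).
Proof.
split.
  have [_ [d _ ->]] := (facet_all D (facet f)).2 (ex_intro _ f erefl).
  by rewrite mulnS.
move=> m; rewrite facet_preimageE => -[z [Zz /= z0] <-].
have /levelZP[xi mz] := Zz.
have [v hv [Zvz below]] := vertex_near Zz mz.
pose f' : facets_at D v := exist _ f (below f z0).
have [e [e' [eK e'K nE]]] := enum_facets_at_last hv f'.
exists (vertex_chart e e'); split.
- exact: vertex_chart_atlas.
- by apply/delzant_space_atP.
have half_last (i : 'I_(2 * n)) : (2 * n - 2 <= i)%N -> half_ord i = e' f'.
  move=> hi; apply: val_inj => /=; have := ltn_ord i; move: (nat_of_ord i) hi => k.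
  by have := nE; lia.
apply/seteqP; split=> [_ [m' [hm' Sm'] <-]|y [[m' hm' <-] y0]].
  split; first by exists m'.
  move: Sm' => -[z' [Zz' /= z'0] zm'] i hi.
  rewrite /= mxE (half_last i hi) e'K -zm' (psi_inv_projM hv Zz').
  have := zc_normal_form z' f'; rewrite z'0 mul0r => -[r0 i0].
  by case: ifP.
exists m' => //; split=> //.
have [z' Zz' zm'] := projM_surj m'.
exists z' => //; split=> //=.
have Zvz' : levelZ_at D v z' by apply/(delzant_space_atP hv Zz'); rewrite zm'.
apply/eqP; rewrite -moment_eq0 -[f]/(val f') -moment_normal_form; last exact: levelZ_at_near.
rewrite moment_eq0; apply/eqP.
have yE : cmap (vertex_chart e e') m' = row_of e (normal_form z').
  by rewrite -zm' /= psi_inv_projM.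
have lt0 : (2 * n - 2 < 2 * n)%N by rewrite -nE; lia.
have lt1 : (2 * n - 1 < 2 * n)%N by rewrite -nE; lia.
have le21 : (2 * n - 2 <= 2 * n - 1)%N by lia.
have := y0 (Ordinal lt1) le21; have := y0 (Ordinal lt0) (leqnn _).
rewrite yE !mxE (half_last (Ordinal lt0) (leqnn _)) (half_last (Ordinal lt1) le21) e'K /=.
have o0 : odd (2 * n - 2) = false by lia.
have o1 : odd (2 * n - 1) by have := nE; lia.
by rewrite o0 o1 => r0 i0; exact: (congr2 (@Complex R) r0 i0).
Qed.

End FacetSubmanifold.

(** * Deforming curves into the preimage of a facet *)

Section SmoothMore.
Context {R : realType}.

Lemma open_preimageI (E : normedModType R) (Y : normedModType R) (U : set E)
    (h : E -> Y) (B : set Y) :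
  open U -> Ck 0 U h -> open B -> open (U `&` h @^-1` B).
Proof.
move=> oU Ch oB; rewrite openE => x [Ux Bx]; apply: filterI.
  exact: open_nbhs_nbhs (conj oU Ux).
have hB : nbhs (h x) B -> nbhs x (h @^-1` B) by exact: (Ch x Ux).
by apply: hB; exact: open_nbhs_nbhs (conj oB Bx).
Qed.

Lemma derive_coord p q (h : R^o -> 'M[R]_(p, q)) (t : R^o) i j :
  derivable h t 1 -> ('D_1 h t) i j = 'D_1 (fun s => h s i j : R^o) t.
Proof. by move=> dh; rewrite derive_mx// mxE. Qed.

Lemma derive_re (B : finType) (h : R^o -> cspace R B) (t : R^o) b :
  derivable h t 1 -> re ('D_1 h t) b = 'D_1 (fun s => re (h s) b : R^o) t.
Proof. exact: derive_coord. Qed.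

Lemma derive_im (B : finType) (h : R^o -> cspace R B) (t : R^o) b :
  derivable h t 1 -> im ('D_1 h t) b = 'D_1 (fun s => im (h s) b : R^o) t.
Proof. exact: derive_coord. Qed.

Lemma derive_scale1 (a b : R^o -> R^o) (t : R^o) :
  derivable a t 1 -> derivable b t 1 -> a t = 1 -> 'D_1 a t = 0 ->
  'D_1 (fun s => a s * b s : R^o) t = 'D_1 b t.
Proof.
move=> da db a1 a0; have -> : 'D_1 (fun s => a s * b s : R^o) t = a t *: 'D_1 b t + b t *: 'D_1 a t.
  exact: (deriveM da db).
by rewrite a1 a0 scale1r scaler0 addr0.
Qed.

Lemma derive_mul_null (a b : R^o -> R^o) (t : R^o) :
  derivable a t 1 -> derivable b t 1 -> a t = 0 -> 'D_1 a t = 0 ->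
  'D_1 (fun s => a s * b s : R^o) t = 0.
Proof.
move=> da db a1 a0; have -> : 'D_1 (fun s => a s * b s : R^o) t = a t *: 'D_1 b t + b t *: 'D_1 a t.
  exact: (deriveM da db).
by rewrite a1 a0 scale0r scaler0 addr0.
Qed.

Lemma derive_moment_null (B : finType) (h : R^o -> cspace R B) (t : R^o) b (U : set R^o) :
  open U -> U t -> Ck 1 U h -> zc (h t) b = 0 ->
  'D_1 (fun s => moment (h s) b : R^o) t = 0.
Proof.
move=> oU Ut Ch [r0 i0].
have dr : derivable (fun s => re (h s) b : R^o) t 1.
  exact: Ck_derivable (Ck_coord (enum_rank b) ord0 oU Ch) Ut.
have di : derivable (fun s => im (h s) b : R^o) t 1.
  exact: Ck_derivable (Ck_coord (enum_rank b) ord_max oU Ch) Ut.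
pose re' := fun s => re (h s) b : R^o; pose im' := fun s => im (h s) b : R^o.
have sq (a : R^o -> R^o) : derivable a t 1 -> a t = 0 ->
    derivable (fun s => a s * a s : R^o) t 1 /\ 'D_1 (fun s => a s * a s : R^o) t = 0.
  move=> da a0; split; first exact: (derivableM da da).
  have -> : 'D_1 (fun s => a s * a s : R^o) t = a t *: 'D_1 a t + a t *: 'D_1 a t.
    exact: (deriveM da da).
  by rewrite a0 scale0r addr0.
have [d1 D1] := sq re' dr r0; have [d2 D2] := sq im' di i0.
have -> : (fun s => moment (h s) b : R^o) =
    (2^-1 : R) \*: ((fun s => re' s * re' s : R^o) + (fun s => im' s * im' s : R^o)).
  by apply/funext => s; rewrite /moment !expr2 mulrC.
rewrite deriveZ; last exact: (derivableD d1 d2).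
by rewrite (deriveD d1 d2) D1 D2 addr0 scaler0.
Qed.

End SmoothMore.

Section Deformation.
Context {R : realType} {n : nat} {T : torus R n} (D : delzant T).
Local Notation W := (dual T).
Local Notation F := (facets D).
Context {v : W} (hv : is_vertex (polytope D) v).
Local Notation A := (facets_at D v).
Context (f : A) (h : R^o -> cspace R F) (U : set R^o).
Context (oU : open U) (U0 : U 0) (Ch : Cinfty U h)
  (hZ : forall t, U t -> levelZ D (h t)) (h0v : levelZ_at D v (h 0))
  (h0f : zc (h 0) (val f) = 0).

Definition flat (t : R^o) : cspace R A :=
  cvec (fun a => if a == f then 0 else re (h t) (val a))
       (fun a => if a == f then 0 else im (h t) (val a)).

Lemma moment_flat t a :
  moment (flat t) a = if a == f then 0 else moment (h t) (val a).
Proof. by rewrite moment_cvec; case: ifP => // _; rewrite expr0n/= addr0 mul0r. Qed.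

Lemma height_flat t g : U t -> height g (moment_at D v (flat t)) =
  moment (h t) g - ncoord f (normal g) * moment (h t) (val f).
Proof.
move=> Ut; have /levelZP[xi mz] := hZ Ut.
have := height_moment_at hv (rho D v (h t)) g.
rewrite (moment_at_rho hv mz) -mz => ->.
rewrite (height_moment_at hv) (bigD1 f)//= [in RHS](bigD1 f)//= moment_flat eqxx moment_rho.
have -> : \sum_(i | i != f) ncoord i (normal g) * moment (flat t) i =
    \sum_(i | i != f) ncoord i (normal g) * moment (rho D v (h t)) i.
  by apply: eq_bigr => a /negPf af; rewrite moment_flat af moment_rho.
by ring.
Qed.

Lemma Ck_flat k : Ck k U flat.
Proof.
apply: Ck_mx => // i j; under eq_fun do rewrite mxE.
case: (j == ord0); case: (enum_val i == f); try exact: Ck_cst;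
  by apply: Ck_coord => //; exact: Ch.
Qed.

Definition flat_dom : set R^o :=
  (U `&` h @^-1` near_vertex (v := v)) `&` flat @^-1` @chart_dom _ _ _ D v.

Lemma flat_dom_sub t : flat_dom t -> U t.
Proof. by move=> [[]]. Qed.

Lemma open_flat_dom : open flat_dom.
Proof.
have oV : open (U `&` h @^-1` @near_vertex _ _ _ D v).
  exact: open_preimageI oU (Ch 0) (@open_near_vertex _ _ _ D v).
apply: open_preimageI oV _ _; last exact: open_chart_dom.
by apply: Ck_sub (Ck_flat 0) => t [].
Qed.

Lemma moment_h0f : moment (h 0) (val f) = 0.
Proof. by apply/eqP; rewrite moment_eq0 h0f. Qed.

Lemma flat_dom0 : flat_dom 0.
Proof.
have hn := levelZ_at_near hv h0v; split=> [|g vg]; first by split.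
by rewrite (height_flat _ U0) moment_h0f mulr0 subr0; exact: hn.
Qed.

Definition stretch t g : R^o := Num.sqrt (height g (moment_at D v (flat t)) / moment (h t) g).

Lemma near_vertex_neq0 t g : flat_dom t -> v \notin facet g -> 0 < moment (h t) g.
Proof. by move=> [[_ hn] _] vg; exact: hn. Qed.

Lemma Ck_ratio k g : v \notin facet g ->
  Ck k flat_dom (fun t => height g (moment_at D v (flat t)) / moment (h t) g : R^o).
Proof.
move=> vg; have od := open_flat_dom; apply: Ck_mul => //.
  apply: (@Ck_comp _ _ _ _ k flat_dom setT flat (fun u => height g (moment_at D v u))) => //.
  - exact: openT.
  - by apply: Ck_sub (Ck_flat k) => t /flat_dom_sub.
  - by apply: (Ck_height_moment_at hv); exact: openT.
apply: Ck_inv => // [t dt|].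
  by rewrite gt_eqF// near_vertex_neq0.
by apply: Ck_moment => //; apply: Ck_sub (Ch k) => t /flat_dom_sub.
Qed.

Lemma ratio_gt0 t g : flat_dom t -> v \notin facet g ->
  0 < height g (moment_at D v (flat t)) / moment (h t) g.
Proof.
by move=> dt vg; rewrite divr_gt0// ?near_vertex_neq0//; case: dt => _; exact.
Qed.

Lemma Ck_stretch k g : v \notin facet g -> Ck k flat_dom (stretch^~ g).
Proof.
move=> vg; apply: Ck_sqrt; [exact: open_flat_dom| |exact: Ck_ratio].
by move=> t dt; exact: ratio_gt0.
Qed.

Lemma stretch0 g : v \notin facet g -> stretch 0 g = 1.
Proof.
move=> vg; rewrite /stretch (height_flat _ U0) moment_h0f mulr0 subr0 divff ?sqrtr1//.
by rewrite gt_eqF// (near_vertex_neq0 flat_dom0).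
Qed.

Lemma derive_stretch0 g : v \notin facet g -> 'D_1 (stretch^~ g) (0 : R^o) = 0.
Proof.
move=> vg; have d0 := flat_dom0.
have [_ ->] := derive_comp_sqrt (1 : R^o) (Ck_differentiable (Ck_ratio 1 vg) d0) (ratio_gt0 d0 vg).
have CU1 : Ck 1 U h by exact: Ch.
pose a t : R^o := moment (h t) (val f).
pose b t : R^o := - ncoord f (normal g) * (moment (h t) g)^-1.
have Ca : Ck 1 flat_dom a.
  by apply: Ck_moment; [exact: open_flat_dom|apply: Ck_sub CU1 => t /flat_dom_sub].
have Cb : Ck 1 flat_dom b.
  apply: Ck_mul; [exact: open_flat_dom|exact: Ck_cst|].
  apply: Ck_inv; [exact: open_flat_dom|by move=> t dt; rewrite gt_eqF// near_vertex_neq0|].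
  by apply: Ck_moment; [exact: open_flat_dom|apply: Ck_sub CU1 => t /flat_dom_sub].
have da : derivable a 0 1 := Ck_derivable Ca d0.
have db : derivable b 0 1 := Ck_derivable Cb d0.
have ab0 : 'D_1 (fun s => a s * b s : R^o) (0 : R^o) = 0.
  apply: (derive_mul_null da db); first exact: moment_h0f.
  exact: (derive_moment_null oU U0 CU1 h0f).
have dab : derivable (fun s => a s * b s : R^o) (0 : R^o) 1 by exact: (derivableM da db).
rewrite (near_eq_derive (g := (cst (1 : R^o) + (fun s => a s * b s : R^o)))) ?oner_eq0//.
  by rewrite (deriveD (derivable_cst _ _ _) dab) ab0 derive_cst addr0 mulr0.
have : nbhs (0 : R^o) flat_dom by exact: open_nbhs_nbhs (conj open_flat_dom d0).
apply: filterS => t dt; rewrite /= height_flat; last exact: flat_dom_sub.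
rewrite mulrBl divff; last by rewrite gt_eqF// near_vertex_neq0.
by rewrite !fctE /a /b; ring.
Qed.

(** The given curve pushed into the set where the coordinate of f vanishes: the
   coordinates at the other facets through v are kept, and those at the facets
   away from v are rescaled to stay on the level set. Their scaling factors have
   derivative 0, since |z_f|^2 vanishes to second order at time 0. *)
Definition deformed (t : R^o) : cspace R F :=
  cvec (fun g => if g == val f then 0 else
                 if v \in facet g then re (h t) g else stretch t g * re (h t) g)
       (fun g => if g == val f then 0 else
                 if v \in facet g then im (h t) g else stretch t g * im (h t) g).

Lemma Ck_deformed k : Ck k flat_dom deformed.
Proof.
have od := open_flat_dom; have Chd : Ck k flat_dom h.
  by apply: Ck_sub (Ch k) => t /flat_dom_sub.
apply: Ck_mx => // i j; under eq_fun do rewrite mxE.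
case: (j == ord0); (case: (enum_val i == val f); first exact: Ck_cst);
  (case: (boolP (v \in facet (enum_val i))) => vg; first by apply: Ck_coord);
  by apply: Ck_mul => //; [exact: Ck_stretch|apply: Ck_coord].
Qed.

Lemma deformed_level t : flat_dom t -> facet_levelZ (val f) (deformed t).
Proof.
move=> dt; split; last by rewrite /= zc_cvec eqxx.
apply/levelZP; exists (moment_at D v (flat t)) => g.
rewrite moment_cvec; case: eqP => [->|/eqP gf].
  by rewrite (moment_at_spec hv) moment_flat eqxx expr0n/= addr0 mul0r.
case: (boolP (v \in facet g)) => vg.
  have gE : g = val (exist (fun g : F => v \in facet g) g vg) by [].
  rewrite [in RHS]gE (moment_at_spec hv) moment_flat; case: eqP => // gf'.
  by move: gf; rewrite gE gf' eqxx.
rewrite !exprMn -mulrDr sqr_sqrtr; last by rewrite ltW// ratio_gt0.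
rewrite -mulrA -/(moment (h t) g) divfK//.
by rewrite gt_eqF// near_vertex_neq0.
Qed.

Lemma deformed0 : deformed 0 = h 0.
Proof.
apply: zcP => g; rewrite zc_cvec; case: eqP => [->|_]; first by rewrite h0f.
by case: ifPn => // vg; rewrite stretch0// !mul1r.
Qed.

Lemma derive_deformed g : g != val f ->
  re ('D_1 deformed (0 : R^o)) g = re ('D_1 h (0 : R^o)) g /\
  im ('D_1 deformed (0 : R^o)) g = im ('D_1 h (0 : R^o)) g.
Proof.
move=> gf; have dd : derivable deformed 0 1 := Ck_derivable (Ck_deformed 1) flat_dom0.
have dh : derivable h 0 1 := Ck_derivable (Ch 1) U0.
have dr j : derivable (fun t => h t (enum_rank g) j : R^o) 0 1.
  exact: Ck_derivable (Ck_coord (enum_rank g) j oU (Ch 1)) U0.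
have ds (vg : v \notin facet g) : derivable (stretch^~ g) 0 1 :=
  Ck_derivable (Ck_stretch 1 vg) flat_dom0.
split.
  apply: etrans (derive_re g dd) _; apply: etrans _ (esym (derive_re g dh)).
  rewrite /deformed; under eq_fun do rewrite re_cvec (negPf gf).
  case: (boolP (v \in facet g)) => [//|vg].
  exact: (derive_scale1 (ds vg) (dr ord0) (stretch0 vg) (derive_stretch0 vg)).
apply: etrans (derive_im g dd) _; apply: etrans _ (esym (derive_im g dh)).
rewrite /deformed; under eq_fun do rewrite im_cvec (negPf gf).
case: (boolP (v \in facet g)) => [//|vg].
exact: (derive_scale1 (ds vg) (dr ord_max) (stretch0 vg) (derive_stretch0 vg)).
Qed.

End Deformation.

(** * Nondegeneracy along the preimage of a facet *)

Section SymplecticFacet.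
Context {R : realType} {n : nat} {T : torus R n} (D : delzant T).
Local Notation W := (dual T).
Local Notation F := (facets D).
Local Notation M := (delzant_space D).

Lemma sigma_ext (B : finType) (b : B) (a c c' : cspace R B) :
  re a b = 0 -> im a b = 0 ->
  (forall g, g != b -> re c g = re c' g /\ im c g = im c' g) ->
  sigma a c = sigma a c'.
Proof.
move=> r0 i0 cc'; congr (_ * _); apply: eq_bigr => g _.
have [->|gb] := eqVneq g b; first by rewrite r0 i0 !mul0r.
by have [-> ->] := cc' g gb.
Qed.

Lemma curve_facet (c : chart R M (2 * n)) (f : F) (h : R^o -> cspace R F) (V : set R^o) :
  delzant_atlas D c -> open V -> V 0 -> Cinfty V h ->
  (forall t, V t -> facet_levelZ f (h t)) -> cdom c (projM D (h 0)) ->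
  curve_at (cmap c @` (cdom c `&` moment_T D @^-1` facet f))
    (cmap c (projM D (h 0))) (cmap c \o projM D \o h).
Proof.
move=> [ic sm _] oV V0 Ch hf hc0.
have [ocd _ _ _ _] := ic.
have [G [g [oG G0 Cg gE]]] := sm (h 0) (conj (hf 0 V0).1 hc0).
have [U oU UE] := (open_delzantP (cdom c)).1 ocd.
have UZ z : levelZ D z -> U z <-> cdom c (projM D z).
  move=> Zz; split=> h1.
    have : (levelZ D `&` U) z by split.
    by rewrite -UE => -[].
  have : (levelZ D `&` projM D @^-1` cdom c) z by split.
  by rewrite UE => -[].
have oV' := open_preimageI oV (Ch 0) (openI oG oU).
have hc t : (V `&` h @^-1` (G `&` U)) t -> cdom c (projM D (h t)).
  by move=> [Vt [_ Ut]]; apply/(UZ _ (hf t Vt).1).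
exists (V `&` h @^-1` (G `&` U)); split.
- exact: oV'.
- split; first exact: V0.
  by split; [exact: G0|apply/(UZ _ (hf 0 V0).1)].
- move=> k; apply: (Ck_eq (f := g \o h) oV') => [t Vt|].
    have [Vt1 [Gt _]] := Vt; rewrite /= gE// inE.
    by split; [exact: Gt|split; [exact: (hf t Vt1).1|exact: hc]].
  apply: (Ck_comp_mx oV' oG _ _ (Cg k)); first by move=> t [_ []].
  by apply: Ck_sub (Ch k) => t [].
- move=> _ [t Vt <-]; exists (projM D (h t)) => //; split; first exact: hc.
  have Vt1 := Vt.1; apply/(facet_moment_T f (hf t Vt1).1); exact: (hf t Vt1).2.
- by [].
Qed.

Lemma near_derive (E : normedModType R) (V : set R^o) (a b : R^o -> E) :
  open V -> V 0 -> (forall t, V t -> a t = b t) -> 'D_1 a (0 : R^o) = 'D_1 b (0 : R^o).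
Proof.
move=> oV V0 ab; apply: near_eq_derive.
have : nbhs (0 : R^o) V by exact: open_nbhs_nbhs (conj oV V0).
by apply: filterS => t; exact: ab.
Qed.

Lemma line_derive p q (y r : 'M[R]_(p, q)) :
  Cinfty setT (fun t : R^o => y + t *: r) /\ 'D_1 (fun t : R^o => y + t *: r) (0 : R^o) = r.
Proof.
have C : Cinfty setT (fun t : R^o => y + t *: r).
  move=> k; apply: Ck_mx => [|i j]; first exact: openT.
  under eq_fun do rewrite !mxE.
  apply: Ck_add; [exact: openT|exact: Ck_cst|].
  apply: Ck_mul; [exact: openT| |exact: Ck_cst].
  by apply: (@Ck_linear _ _ _ _ _ idfun) => t.
split=> //; apply/matrixP => i j; rewrite derive_coord; last first.
  exact: Ck_derivable (C 1) (Logic.I : setT 0).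
have -> : (fun s : R^o => (y + s *: r) i j : R^o) = cst (y i j : R^o) + (r i j : R) \*: (@id R^o).
  by apply/funext => s; rewrite !mxE [s * _]mulrC.
have did : derivable (@id R^o) 0 1 by exact: derivable_id.
have dc : derivable (cst (y i j : R^o) : R^o -> R^o) 0 1 by exact: derivable_cst.
rewrite (deriveD dc (derivableZ did)) derive_cst add0r.
by rewrite (deriveZ _ did) derive_id; exact: mulr1.
Qed.

(** Nondegeneracy on the preimage of a facet: lifting tangent vectors to curves
   of the level set, a vector u tangent to the preimage of the facet has the same
   pairing with any tangent vector r of M as with a vector tangent to the
   preimage, given by the deformed curve. So if u is orthogonal to the tangent
   space of the preimage, it is orthogonal to that of M and u = 0. *)
Lemma symplectic_on_facet_preimage (w : form2) (f : F) :
  symplectic_form (delzant_atlas D) w -> pullback_eq D w ->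
  symplectic_on (delzant_atlas D) w (moment_T D @^-1` facet f).
Proof.
move=> [_ _ nondeg] pb c x Ac cx Sx /= u [g [Vg [oVg Vg0 Cg gA g0]] <-] orth.
have cy : cimg c (cmap c x) by exists x.
apply: (nondeg c (cmap c x) _ Ac cy) => r.
have [ic _ lifts] := Ac; have [ocd oci cK _ _] := ic.
have [L [s [oL [Ly Lc] Cs sZ sE]]] := lifts _ cy.
have sEL y : L y -> projM D (s y) = cinv c y by move=> hy; apply: sE; rewrite inE.
have mapK y : cimg c y -> cmap c (cinv c y) = y by move=> [x' cx' <-]; rewrite cK.
set y0 := cmap c x in cy Ly g0 orth *.
have Zs y : L y -> levelZ D (s y) by move=> hy; apply: sZ; exists y.
have z0x : projM D (s y0) = x by rewrite sEL// /y0 cK.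
have zf : zc (s y0) f = 0.
  by apply/(facet_moment_T f (Zs _ Ly)); rewrite z0x.
(* Lift the curve g representing u to a curve ga of the level set. *)
have oV1 := open_preimageI oVg (Cg 0) oL.
set V1 := Vg `&` g @^-1` L in oV1.
have V10 : V1 0 by split=> //; rewrite /preimage/= g0.
pose ga := s \o g.
have Cga : Cinfty V1 ga.
  move=> k; apply: (Ck_comp_mx oV1 oL _ _ (Cs k)); first by move=> t [].
  by apply: Ck_sub (Cg k) => t [].
have gaf t : V1 t -> zc (ga t) f = 0.
  move=> [Vt Lt]; have [x' [cx' Sx'] gE] : (cmap c @` (cdom c `&` moment_T D @^-1` facet f)) (g t).
    by apply: gA; exists t.
  apply/(facet_moment_T f (Zs _ Lt)); rewrite sEL// -gE cK//.
have ga_curve : curve_at (levelZ D) (s y0) ga.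
  exists V1; split=> //; last by rewrite /ga/= g0.
  by move=> _ [t [_ Lt] <-]; exact: Zs.
have uE : 'D_1 g (0 : R^o) = 'D_1 (cmap c \o projM D \o ga) (0 : R^o).
  apply: (near_derive oV1 V10) => t [_ Lt].
  by rewrite /= /ga /= sEL// mapK//; exact: Lc.
(* Lift a line of direction r in the chart to a curve et of the level set. *)
pose line := fun t : R^o => y0 + t *: r.
have [cline dline] := line_derive y0 r.
have oV2 := open_preimageI openT (cline 0) oL.
set V2 := setT `&` _ in oV2.
have V20 : V2 0 by split=> //; rewrite /preimage/= scale0r addr0.
pose et := s \o line.
have Cet : Cinfty V2 et.
  move=> k; apply: (Ck_comp_mx oV2 oL _ _ (Cs k)); first by move=> t [].
  by apply: Ck_sub (cline k) => t [].
have et0 : et 0 = s y0 by rewrite /et/= /line scale0r addr0.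
have etZ t : V2 t -> levelZ D (et t) by move=> [_ Lt]; exact: Zs.
have et_curve : curve_at (levelZ D) (s y0) et.
  by exists V2; split=> // _ [t Vt <-]; exact: etZ.
have rE : 'D_1 (cmap c \o projM D \o et) (0 : R^o) = r.
  transitivity ('D_1 line (0 : R^o)).
    apply: (near_derive oV2 V20) => t [_ Lt].
    by rewrite /= /et /= sEL// mapK//; exact: Lc.
  exact: dline.
(* Deform et; its derivative changes only at f, where that of ga vanishes. *)
have /levelZP[xi mz] := Zs _ Ly.
have [v hv [Zvz below]] := vertex_near (Zs _ Ly) mz.
pose f' : facets_at D v := exist (fun g : F => v \in facet g) f (below f zf).
have etv : levelZ_at D v (et 0) by rewrite et0.
have etf : zc (et 0) (val f') = 0 by rewrite et0.
have dom0 := flat_dom0 hv V20 etZ etv etf.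
have odom := open_flat_dom hv (f := f') oV2 Cet.
have Cdf := Ck_deformed hv f' oV2 Cet.
have df0 : deformed f' et 0 = s y0 by rewrite (deformed0 hv V20 etZ etv etf).
have df_curve : curve_at (levelZ D) (s y0) (deformed f' et).
  exists (flat_dom f' et V2); split=> // _ [t dt <-].
  by have [] := deformed_level hv dt.
have cdf : cdom c (projM D (deformed f' et 0)) by rewrite df0 z0x.
have push := curve_facet Ac odom dom0 Cdf (fun t dt => deformed_level hv dt) cdf.
rewrite df0 z0x in push.
have cz0 : cdom c (projM D (s y0)) by rewrite z0x.
have pair_et := pb c _ ga et Ac cz0 ga_curve et_curve.
have pair_df := pb c _ ga (deformed f' et) Ac cz0 ga_curve df_curve.
rewrite z0x -uE rE in pair_et; rewrite z0x -uE in pair_df.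
have dga : derivable ga 0 1 := Ck_derivable (Cga 1) V10.
have ga0 (j : R^o -> R^o) : (forall t, V1 t -> j t = 0) -> 'D_1 j (0 : R^o) = 0.
  by move=> j0; rewrite (near_derive oV1 V10 (b := cst 0))// derive_cst.
have ra : re ('D_1 ga (0 : R^o)) f = 0.
  by rewrite (derive_re f dga); apply: ga0 => t /gaf[].
have ia : im ('D_1 ga (0 : R^o)) f = 0.
  by rewrite (derive_im f dga); apply: ga0 => t /gaf[].
rewrite -/y0 in pair_et pair_df *; rewrite pair_et.
rewrite -(sigma_ext ra ia (derive_deformed hv oV2 V20 Cet etZ etv etf)) -pair_df.
by apply: orth; exists (cmap c \o projM D \o deformed f' et).
Qed.

End SymplecticFacet.

Theorem corollary3p7 (R : realType) (n : nat) (T : torus R n) (D : delzant T) :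
  (forall w : form2,
     symplectic_form (delzant_atlas D) w -> pullback_eq D w ->
     forall f : facets D,
       let S := moment_T D @^-1` facet f in
       [/\ submanifold (delzant_atlas D) 2 S, compact S, connected S
         & symplectic_on (delzant_atlas D) w S]) /\
  (forall v : dual T, is_vertex (polytope D) v ->
     [/\ dense (delzant_space_at D v),
         psi D v @` domU D v = delzant_space_at D v
       & maximal_diffeo (delzant_atlas D) (domU D v) (psi D v)]).
Proof.
split=> [w sw pw f S|v hv]; split.
- exact: submanifold_facet_preimage.
- exact: compact_facet_preimage.
- exact: connected_facet_preimage.
- exact: symplectic_on_facet_preimage.
- exact: dense_delzant_space_at.
- exact: psi_image.
- exact: psi_maximal.
Qed.
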